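(* There is a polynomial-time $\tfrac{3}{2}$-approximation algorithm for the graph balancing problem restricted to instances in which the edge weights take at most two distinct values. That is, there is a polynomial-time algorithm which, given a finite undirected multigraph $G=(V,E)$ (parallel edges and self-loops allowed) with positive weights $p_e$, $e\in E$, satisfying $|\{p_e : e\in E\}|\le 2$, outputs an orientation of $G$ whose maximum weighted in-degree is at most $\tfrac{3}{2}\,\mathsf{OPT}$.
   Context: Graph balancing problem: given a finite undirected multigraph $G=(V,E)$ (parallel edges and loops allowed) with positive edge weights $p_e$, an orientation assigns each edge $e$ to one of its endpoints (its head; a loop at $v$ is assigned to $v$). The weighted in-degree of a vertex $v$ is the sum of $p_e$ over edges whose head is $v$. The makespan of an orientation is the maximum weighted in-degree over all vertices, and $\mathsf{OPT}$ is the minimum makespan over all orientations. *)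

(* Defs.v *)
From mathcomp Require Import all_boot all_order all_algebra.
Set Implicit Arguments.
Unset Strict Implicit.
Unset Printing Implicit Defensive.
Import Order.TTheory GRing.Theory Num.Theory.

(* The model of computation is a first-order language of mutually recursive
   functions on binary trees with natural numbers at the leaves, under the
   logarithmic cost criterion: numbers are measured by their binary length, and
   evaluating an expression costs, on top of its subexpressions, one unit plus
   the size of the value it returns (also when a value is merely copied).  A run
   of cost t thus handles only values of total size at most t using polynomial-time
   primitives, and conversely one Turing machine step is a bounded number of
   operations on trees, so the functions computable here at polynomial cost are
   exactly those computable in polynomial time by a Turing machine. *)

Inductive data : Type :=
| Atom of nat
| Pair of data & data.

Fixpoint dsize (d : data) : nat :=
  match d with
  | Atom n => (trunc_log 2 n).+1
  | Pair a b => (dsize a + dsize b).+1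
  end.

Definition dfst (d : data) : data := if d is Pair a _ then a else Atom 0.
Definition dsnd (d : data) : data := if d is Pair _ b then b else Atom 0.
Definition is_pair (d : data) : bool := if d is Pair _ _ then true else false.
Definition dnat (d : data) : nat := if d is Atom n then n else 0.

Inductive binop : Type := OpAdd | OpSub | OpMul | OpDiv | OpLeq.

Definition binop_nat (o : binop) (m n : nat) : nat :=
  match o with
  | OpAdd => m + n
  | OpSub => m - n
  | OpMul => m * n
  | OpDiv => m %/ n
  | OpLeq => m <= n
  end.

(* [Var i] is a de Bruijn index: [LetIn] pushes a value on the environment, and
   the body of a function is evaluated in the environment consisting of its
   single argument.  [Call f e] calls the f-th function of the program. *)
Inductive expr : Type :=
| Var of nat
| Const of nat
| MkPair of expr & expr
| Fst of expr
| Snd of expr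
| IsPair of expr
| Binop of binop & expr & expr
| If of expr & expr & expr
| LetIn of expr & expr
| Call of nat & expr.

Definition program : Type := seq expr.

(* [eval p env e d t]: in the program [p] and the environment [env], the
   evaluation of [e] terminates with value [d] and cost [t].  Ill-typed
   operations and dangling references yield [Atom 0]; a condition is false
   when it is [Atom 0] or a pair. *)
Inductive eval (p : program) : seq data -> expr -> data -> nat -> Prop :=
| EvalVar env i :
    eval p env (Var i) (nth (Atom 0) env i) (dsize (nth (Atom 0) env i)).+1
| EvalConst env n :
    eval p env (Const n) (Atom n) (dsize (Atom n)).+1
| EvalMkPair env e1 e2 d1 d2 t1 t2 :
    eval p env e1 d1 t1 -> eval p env e2 d2 t2 ->
    eval p env (MkPair e1 e2) (Pair d1 d2)
      (t1 + t2 + (dsize (Pair d1 d2)).+1)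
| EvalFst env e d t :
    eval p env e d t ->
    eval p env (Fst e) (dfst d) (t + (dsize (dfst d)).+1)
| EvalSnd env e d t :
    eval p env e d t ->
    eval p env (Snd e) (dsnd d) (t + (dsize (dsnd d)).+1)
| EvalIsPair env e d t :
    eval p env e d t ->
    eval p env (IsPair e) (Atom (is_pair d)) (t + (dsize (Atom (is_pair d))).+1)
| EvalBinop env o e1 e2 d1 d2 t1 t2 :
    eval p env e1 d1 t1 -> eval p env e2 d2 t2 ->
    eval p env (Binop o e1 e2) (Atom (binop_nat o (dnat d1) (dnat d2)))
      (t1 + t2 + (dsize (Atom (binop_nat o (dnat d1) (dnat d2)))).+1)
| EvalIf env e1 e2 e3 d1 d t1 t :
    eval p env e1 d1 t1 -> eval p env (if dnat d1 != 0 then e2 else e3) d t ->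
    eval p env (If e1 e2 e3) d (t1 + t + (dsize d).+1)
| EvalLet env e1 e2 d1 d t1 t :
    eval p env e1 d1 t1 -> eval p (d1 :: env) e2 d t ->
    eval p env (LetIn e1 e2) d (t1 + t + (dsize d).+1)
| EvalCall env f e d1 d t1 t :
    eval p env e d1 t1 -> eval p [:: d1] (nth (Const 0) p f) d t ->
    eval p env (Call f e) d (t1 + t + (dsize d).+1).

(* The entry point of a program is its function number 0. *)
Definition runs (p : program) (input output : data) (t : nat) : Prop :=
  eval p [:: input] (nth (Const 0) p 0) output t.

Lemma eval_det (p : program) env e d1 t1 d2 t2 :
  eval p env e d1 t1 -> eval p env e d2 t2 -> d1 = d2 /\ t1 = t2.
Proof.
move=> H; elim: H d2 t2 => {env e d1 t1};
  intros; match goal with H : eval _ _ _ _ _ |- _ => inversion H; subst => // end;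
  repeat match goal with
  | IH : (forall d t, eval p ?env ?e d t -> _), H : eval p ?env ?e _ _ |- _ =>
    let E1 := fresh in let E2 := fresh in
    case: (IH _ _ H) => E1 E2; subst; clear IH
  end => //.
Qed.

Lemma dsize_le_cost (p : program) env e d t : eval p env e d t -> dsize d < t.
Proof. by case=> *; rewrite ?leq_addl. Qed.

Local Open Scope ring_scope.

(* The order of the two components of [ends e] carries no meaning, and
   [e] is a loop when they coincide. *)
Record instance : Type := Instance {
  vertex : finType;
  edge : finType;
  ends : edge -> vertex * vertex;
  weight : edge -> rat;
  weight_gt0 : forall e, 0 < weight e
}.

Section Balancing.

Variable G : instance.

Definition assignment : finType := {ffun edge G -> vertex G}.

Definition is_orientation (o : assignment) : bool :=
  [forall e, (o e == (ends e).1) || (o e == (ends e).2)].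

Definition indegree (o : assignment) (v : vertex G) : rat :=
  \sum_(e | o e == v) weight e.

(* Loads are nonnegative, so the default value 0 only matters for the graph
   without vertices. *)
Definition makespan (o : assignment) : rat :=
  \big[Order.max/0]_(v : vertex G) indegree o v.

Definition default_orientation : assignment := [ffun e => (ends e).1].

Lemma default_orientationP : is_orientation default_orientation.
Proof. by apply/forallP => e; rewrite ffunE eqxx. Qed.

Definition OPT : rat :=
  makespan [arg min_(o < default_orientation | is_orientation o) makespan o]%O.

Definition at_most_two_weights : bool :=
  (size (undup [seq weight e | e <- enum (edge G)]) <= 2)%N.

End Balancing.

(* Vertices are named by their ranks, an edge is the triple of its
   endpoints and its weight (a fraction in lowest terms), and a graph is the
   list of its vertices together with the list of its edges.  An orientation is
   the list of the heads of the edges, in the order in which the edges are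
   listed in the input. *)

Fixpoint enc_seq (s : seq data) : data :=
  if s is x :: s' then Pair x (enc_seq s') else Atom 0.

Definition enc_vertex (V : finType) (v : V) : data := Atom (enum_rank v).

Definition enc_weight (r : rat) : data := Pair (Atom `|numq r|) (Atom `|denq r|).

Definition enc_edge (G : instance) (e : edge G) : data :=
  Pair (Pair (enc_vertex (ends e).1) (enc_vertex (ends e).2))
       (enc_weight (weight e)).

Definition enc_instance (G : instance) : data :=
  Pair (enc_seq [seq enc_vertex v | v <- enum (vertex G)])
       (enc_seq [seq enc_edge e | e <- enum (edge G)]).

Definition enc_orientation (G : instance) (o : assignment G) : data :=
  enc_seq [seq enc_vertex (o e) | e <- enum (edge G)].

Definition poly_time_on (P : instance -> Prop) (p : program) : Prop :=
  exists c k : nat, forall G : instance, P G ->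
    exists (output : data) (t : nat),
      runs p (enc_instance G) output t /\
      (t <= c * dsize (enc_instance G) ^ k + c)%N.

Definition approximates_on (P : instance -> Prop) (rho : rat) (p : program) :
    Prop :=
  forall G : instance, P G ->
    exists (o : assignment G) (t : nat),
      [/\ runs p (enc_instance G) (enc_orientation o) t,
          is_orientation o
        & makespan o <= rho * OPT G].

(* Main.v *)
Require Import Defs.
From HB Require Import structures.
From mathcomp Require Import all_boot all_order all_algebra.
From mathcomp Require Import zify.
Set Implicit Arguments.
Unset Strict Implicit.
Unset Printing Implicit Defensive.
Import Order.TTheory GRing.Theory Num.Theory.

(* Let s <= b be the two weights (scaled to integers) and T = OPT.  The
   algorithm tries every pair (i, j) of numbers at most |E|, computes two
   candidate orientations for each, and returns the best one.

   If 2b <= T, a push-relabel procedure with capacity T + b <= 3T/2 works: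
   overloaded vertices pass an edge to an end of smaller height, or are
   relabelled; a vertex of positive height always has load at least T, so a gap
   in the heights would exhibit a set of vertices whose inner edges weigh more
   than T per vertex.

   If T < 2b, every vertex is the head of at most one big edge in an optimal
   orientation.  Let h be the number of small edges that fit with a big edge,
   and h + g the number that fit without one.  Cut each big edge into g unit
   tokens; by push-relabel, tokens and small edges can be assigned so that each
   vertex v gets at most h small edges plus x(v) extra ones, where x(v) plus its
   number of tokens is at most g.  The vertices with x(v) > g/2 number at most
   one per tree component of the graph of big edges, and there are none in
   unicyclic components, so the big edges can be oriented away from them with
   in-degree at most one.  A vertex with a big edge then has load at most
   b + s(h + g/2) = ((b + sh) + s(g + h) + b)/2 <= 3T/2.

   Polynomial time is a closure property: total functions on [data] computable
   at polynomial cost are closed under composition and under recursion along a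
   list, provided that each step increases the size of the accumulator
   additively. *)

(** * Polynomial bounds *)

(** A single constant serves as shift and degree, so a bound is weakened just by enlarging [c], and
    constant functions are covered even at [n = 0]. *)
Definition polyb (q : nat -> nat) : Prop := exists c, forall n, q n <= (n + c) ^ c.

Lemma leq_exp a b n : a <= b -> a ^ n <= b ^ n.
Proof. by case: n => // n ab; rewrite leq_exp2r. Qed.

Lemma polyb_le q r : polyb r -> (forall n, q n <= r n) -> polyb q.
Proof. by case=> c H le_qr; exists c => n; apply: leq_trans (le_qr n) _. Qed.

Lemma polyb_const k : polyb (fun=> k).
Proof.
exists k.+1 => n; apply: (@leq_trans (k.+1 ^ k.+1)); last by apply: leq_exp; lia.
by apply: (@leq_trans k.+1) => //; rewrite -{1}(expn1 k.+1) leq_pexp2l.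
Qed.

Lemma polyb_id : polyb id.
Proof. by exists 1 => n; rewrite expn1 leq_addr. Qed.

Lemma polyb_mul q r : polyb q -> polyb r -> polyb (fun n => q n * r n).
Proof.
case=> a Ha [b Hb]; exists (a + b) => n; rewrite expnD leq_mul //.
  by apply: leq_trans (Ha n) _; apply: leq_exp; lia.
by apply: leq_trans (Hb n) _; apply: leq_exp; lia.
Qed.

Lemma polyb_S q : polyb q -> polyb (fun n => (q n).+1).
Proof.
case=> a Ha; exists a.+2 => n; set B := n + a.+2.
have HB : 1 < B by rewrite /B; lia.
have H1 : q n <= B ^ a by apply: leq_trans (Ha n) _; apply: leq_exp; rewrite /B; lia.
have H2 : 0 < B ^ a by rewrite expn_gt0; lia.
have H3 : 2 * 2 <= B * B by rewrite leq_mul.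
by rewrite !expnS mulnA; nia.
Qed.

(** A sum is dominated by the product of the successors, which reduces addition to
    multiplication. *)
Lemma polyb_add q r : polyb q -> polyb r -> polyb (fun n => q n + r n).
Proof.
move=> Hq Hr; apply: (polyb_le (polyb_mul (polyb_S Hq) (polyb_S Hr))) => n.
by rewrite mulSn mulnS; lia.
Qed.

Lemma polyb_pow q c : polyb q -> polyb (fun n => q n ^ c).
Proof.
move=> Hq; elim: c => [|c IH].
  by apply: (polyb_le (polyb_const 1)) => n; rewrite expn0.
by apply: (polyb_le (polyb_mul Hq IH)) => n; rewrite expnS.
Qed.

Lemma polyb_exp q c : polyb q -> polyb (fun n => (q n + c) ^ c).
Proof. by move=> Hq; apply: polyb_pow; apply: polyb_add (polyb_const c). Qed.

Ltac polyb :=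
  repeat first [ exact: polyb_id | exact: polyb_const | apply: polyb_exp
               | apply: polyb_S | apply: polyb_add | apply: polyb_mul | assumption ].

(** * Linking programs *)

Fixpoint reloc (g : nat -> nat) (e : expr) : expr :=
  match e with
  | Var i => Var i
  | Const n => Const n
  | MkPair a b => MkPair (reloc g a) (reloc g b)
  | Fst a => Fst (reloc g a)
  | Snd a => Snd (reloc g a)
  | IsPair a => IsPair (reloc g a)
  | Binop o a b => Binop o (reloc g a) (reloc g b)
  | If a b c => If (reloc g a) (reloc g b) (reloc g c)
  | LetIn a b => LetIn (reloc g a) (reloc g b)
  | Call f a => Call (g f) (reloc g a)
  end.

Lemma eval_reloc (p p' : program) g env e d t :
  (forall f, nth (Const 0) p' (g f) = reloc g (nth (Const 0) p f)) ->
  eval p env e d t -> eval p' env (reloc g e) d t.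
Proof.
move=> Hg; elim=> {env e d t} /=; try by econstructor; eauto.
  move=> env e1 e2 e3 d1 d t1 t _ H1 _ H2; apply: (EvalIf (d1 := d1)) => //.
  by move: H2; case: ifP.
move=> env f e d1 d t1 t _ H1 _ H2; apply: (EvalCall (d1 := d1)) => //.
by rewrite Hg.
Qed.

Definition calls (p : program) (f : nat) (q : program) : Prop :=
  forall env a da ta d t, eval p env a da ta -> runs q da d t ->
  eval p env (Call f a) d (ta + t + (dsize d).+1).

(* An out-of-range call evaluates the default body [Const 0], so relocation has
   to send it out of range again. *)
Lemma link (p q : program) :
  exists f g tail, forall e, calls (e :: tail) f p /\ calls (e :: tail) g q.
Proof.
pose big := (size p + size q).+1.
pose gp f := if f < size p then f.+1 else big.
pose gq f := if f < size q then (size p + f).+1 else big.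
pose tail := map (reloc gp) p ++ map (reloc gq) q.
exists (gp 0), (gq 0), tail => e.
have Hbig : nth (Const 0) (e :: tail) big = Const 0.
  by rewrite nth_default // /tail /= size_cat !size_map.
have Hp f : nth (Const 0) (e :: tail) (gp f) = reloc gp (nth (Const 0) p f).
  rewrite /gp; case: ltnP => hf; last by rewrite Hbig nth_default.
  by rewrite /= nth_cat size_map hf (nth_map (Const 0)).
have Hq f : nth (Const 0) (e :: tail) (gq f) = reloc gq (nth (Const 0) q f).
  rewrite /gq; case: ltnP => hf; last by rewrite Hbig nth_default.
  by rewrite /= nth_cat size_map ltnNge leq_addr /= addKn (nth_map (Const 0)) //.
split=> env a da ta d t Ha Hr; apply: EvalCall Ha _.
  by rewrite Hp; apply: eval_reloc Hr.
by rewrite Hq; apply: eval_reloc Hr.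
Qed.

(** * Polynomial-time functions on data *)

(** [F] is total on [data], not merely on encodings, so composition carries no side condition on
    intermediate values. *)
Definition PT (F : data -> data) : Prop :=
  exists p c, forall d, exists2 t, runs p d (F d) t & t <= (dsize d + c) ^ c.

Lemma PT_intro F (p : program) q :
  polyb q -> (forall d, exists2 t, runs p d (F d) t & t <= q (dsize d)) -> PT F.
Proof.
case=> c Hc H; exists p, c => d; have [t Ht le_t] := H d.
by exists t => //; apply: leq_trans le_t (Hc _).
Qed.

Lemma PT_size F : PT F -> exists c, forall d, dsize (F d) <= (dsize d + c) ^ c.
Proof.
case=> p [c H]; exists c => d; have [t /dsize_le_cost Ht le_t] := H d.
by apply: leq_trans le_t; apply: ltnW.
Qed.

Definition dop (o : binop) (a b : data) : data := Atom (binop_nat o (dnat a) (dnat b)).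
Definition dif (c a b : data) : data := if dnat c != 0 then a else b.
Definition dispair (a : data) : data := Atom (is_pair a).

Lemma dsize_gt0 d : 0 < dsize d.
Proof. by case: d. Qed.

Lemma dsize_fst d : dsize (dfst d) <= dsize d.
Proof. by case: d => [n|a b] //=; lia. Qed.

Lemma dsize_snd d : dsize (dsnd d) <= dsize d.
Proof. by case: d => [n|a b] //=; lia. Qed.

Lemma dsize_bool (b : bool) : dsize (Atom b) = 1.
Proof. by case: b. Qed.

(** Numbers below [x] and [y] have sum and product below [x * y], so bit lengths at most add up; the
    other operations exceed neither their first operand nor 1 at once. *)
Lemma dsize_op o a b : dsize (dop o a b) <= dsize a + dsize b.
Proof.
have Hn d : trunc_log 2 (dnat d) < dsize d by case: d.
suff H m n : trunc_log 2 (binop_nat o m n) <= (trunc_log 2 m + trunc_log 2 n).+1.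
  by have := H (dnat a) (dnat b); have := Hn a; have := Hn b; rewrite /dop /=; lia.
have Hm := trunc_log_ltn m (isT : 1 < 2); have Hk := trunc_log_ltn n (isT : 1 < 2).
have Hlt k : k < 2 ^ (trunc_log 2 m + trunc_log 2 n).+2 ->
    trunc_log 2 k <= (trunc_log 2 m + trunc_log 2 n).+1.
  case: k => [|k] Hlt; first by rewrite trunc_log0.
  have Hk1 := leq_ltn_trans (trunc_logP (isT : 1 < 2) (isT : 0 < k.+1)) Hlt.
  by rewrite ltn_exp2l in Hk1.
rewrite -addSn -addnS expnD in Hlt.
move: (2 ^ _) (2 ^ _) Hm Hk Hlt => x y Hm Hk Hlt.
case: o => /=; try (apply: Hlt; nia).
by case: (m <= n).
Qed.

Lemma PT_id : PT id.
Proof. by apply: (@PT_intro id [:: Var 0] S); [polyb | move=> d; exists (dsize d).+1; first exact: EvalVar]. Qed.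

Lemma PT_const n : PT (fun=> Atom n).
Proof.
apply: (@PT_intro _ [:: Const n] (fun=> (dsize (Atom n)).+1)); first by polyb.
by move=> d; eexists; first exact: EvalConst.
Qed.

Lemma PT_fst0 : PT dfst.
Proof.
apply: (@PT_intro _ [:: Fst (Var 0)] (fun n => n.+1 + n.+1)); first by polyb.
move=> d; eexists; first by apply: EvalFst; exact: EvalVar.
by rewrite /= leq_add // ltnS dsize_fst.
Qed.

Lemma PT_snd0 : PT dsnd.
Proof.
apply: (@PT_intro _ [:: Snd (Var 0)] (fun n => n.+1 + n.+1)); first by polyb.
move=> d; eexists; first by apply: EvalSnd; exact: EvalVar.
by rewrite /= leq_add // ltnS dsize_snd.
Qed.

Lemma PT_ispair0 : PT dispair.
Proof.
apply: (@PT_intro _ [:: IsPair (Var 0)] (fun n => n.+1 + 2)); first by polyb.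
move=> d; eexists; first by apply: EvalIsPair; exact: EvalVar.
by rewrite dsize_bool.
Qed.

Lemma PT_op0 o : PT (fun d => dop o (dfst d) (dsnd d)).
Proof.
apply: (@PT_intro _ [:: Binop o (Fst (Var 0)) (Snd (Var 0))]
  (fun n => (n.+1 + n.+1) + (n.+1 + n.+1) + (n + n).+1)); first by polyb.
move=> d; eexists; first by apply: EvalBinop; [apply: EvalFst | apply: EvalSnd]; exact: EvalVar.
have := dsize_op o (dfst d) (dsnd d); have := dsize_fst d; have := dsize_snd d.
by rewrite /dop /=; move: (trunc_log _ _); lia.
Qed.

Lemma PT_if0 : PT (fun d => dif (dfst d) (dfst (dsnd d)) (dsnd (dsnd d))).
Proof.
apply: (@PT_intro _ [:: If (Fst (Var 0)) (Fst (Snd (Var 0))) (Snd (Snd (Var 0)))]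
  (fun n => (n.+1 + n.+1) + (n.+1 + n.+1 + n.+1) + n.+1)); first by polyb.
move=> d; rewrite /dif.
have H1 := dsize_fst d; have H2 := dsize_snd d.
have H3 := dsize_fst (dsnd d); have H4 := dsize_snd (dsnd d).
exists (((dsize d).+1 + (dsize (dfst d)).+1) +
  ((dsize d).+1 + (dsize (dsnd d)).+1 +
   (dsize (if dnat (dfst d) != 0 then dfst (dsnd d) else dsnd (dsnd d))).+1) +
  (dsize (if dnat (dfst d) != 0 then dfst (dsnd d) else dsnd (dsnd d))).+1).
  apply: EvalIf; first by apply: EvalFst; exact: EvalVar.
  by case: ifP => _; [apply: EvalFst | apply: EvalSnd]; apply: EvalSnd; exact: EvalVar.
by case: ifP => _; lia.
Qed.

Lemma PT_pair F G : PT F -> PT G -> PT (fun d => Pair (F d) (G d)).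
Proof.
case=> p [a Ha] [q [b Hb]]; have [f [g [tl Hl]]] := link p q.
have [Hf Hg] := Hl (MkPair (Call f (Var 0)) (Call g (Var 0))).
apply: (@PT_intro _ (_ :: tl) (fun n => 10 * (n + ((n + a) ^ a + (n + b) ^ b)) + 10)) => [|d].
  by polyb.
have [t1 R1 L1] := Ha d; have [t2 R2 L2] := Hb d.
eexists; first by apply: EvalMkPair; [apply: Hf R1 | apply: Hg R2]; exact: EvalVar.
have := dsize_le_cost R1; have := dsize_le_cost R2.
by move: L1 L2 => /=; lia.
Qed.

Lemma PT_comp F G : PT F -> PT G -> PT (fun d => F (G d)).
Proof.
case=> p [a Ha] [q [b Hb]]; have [f [g [tl Hl]]] := link p q.
have [Hf Hg] := Hl (Call f (Call g (Var 0))).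
apply: (@PT_intro _ (_ :: tl)
  (fun n => 10 * (n + (((n + b) ^ b + a) ^ a + (n + b) ^ b)) + 10)) => [|d].
  by polyb.
have [t2 R2 L2] := Hb d; have [t1 R1 L1] := Ha (G d).
eexists; first by apply: Hf R1; apply: Hg R2; exact: EvalVar.
have H1 := dsize_le_cost R1; have H2 := dsize_le_cost R2.
have H3 : (dsize (G d) + a) ^ a <= ((dsize d + b) ^ b + a) ^ a.
  by apply: leq_exp; move: H2 L2; lia.
by move: L1 L2 H1 H2 H3 => /=; lia.
Qed.

Lemma PT_fst F : PT F -> PT (fun d => dfst (F d)).
Proof. exact: PT_comp PT_fst0. Qed.

Lemma PT_snd F : PT F -> PT (fun d => dsnd (F d)).
Proof. exact: PT_comp PT_snd0. Qed.

Lemma PT_ispair F : PT F -> PT (fun d => dispair (F d)).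
Proof. exact: PT_comp PT_ispair0. Qed.

Lemma PT_op o F G : PT F -> PT G -> PT (fun d => dop o (F d) (G d)).
Proof. by move=> HF HG; exact: PT_comp (PT_op0 o) (PT_pair HF HG). Qed.

Lemma PT_if F G H : PT F -> PT G -> PT H -> PT (fun d => dif (F d) (G d) (H d)).
Proof.
by move=> HF HG HH; exact: PT_comp PT_if0 (PT_pair HF (PT_pair HG HH)).
Qed.

(** * Recursion along lists *)

(** The step receives the whole remaining list, not only its head, so that it can see how many
    entries are left. *)
Fixpoint drec (f : data -> data -> data) (z l : data) : data :=
  if l is Pair _ l' then f l (drec f z l') else z.

(* Additive growth in the accumulator, uniformly in it: iterating such a step
   along a list keeps the accumulator polynomial. *)
Definition AG (S : data -> data -> data) : Prop :=
  exists c, forall y a, dsize (S y a) <= dsize a + (dsize y + c) ^ c.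

Lemma drec_size f z l B :
  (forall l' a, dsize l' <= dsize l -> dsize (f l' a) <= dsize a + B) ->
  dsize (drec f z l) <= dsize z + dsize l * B.
Proof.
elim: l => [n|x _ l IH] H /=; first by lia.
have H0 := H (Pair x l) (drec f z l) (leqnn _).
have := IH (fun l' a h => H l' a (leq_trans h (dsize_snd (Pair x l)))).
by move: H0; rewrite /= mulSn mulnDl; lia.
Qed.

(** The argument packs [((parameter, base), list)]. The entry point is itself the recursive
    function: it calls function number 0 on the tail and passes the result to the program of the
    step. *)
Lemma PT_rec0 (S : data -> data -> data -> data) :
  PT (fun y => S (dfst (dfst y)) (dsnd (dfst y)) (dsnd y)) ->
  AG (fun y a => S (dfst y) (dsnd y) a) ->
  PT (fun y => drec (S (dfst (dfst y))) (dsnd (dfst y)) (dsnd y)).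
Proof.
case=> p [c Hc] [b Hb]; have [f [g [tl Hl]]] := link p p.
have [Hf _] := Hl (If (IsPair (Snd (Var 0)))
  (Call f (MkPair (MkPair (Fst (Fst (Var 0))) (Snd (Var 0)))
                  (Call 0 (MkPair (Fst (Var 0)) (Snd (Snd (Var 0)))))))
  (Snd (Fst (Var 0)))).
move: Hf; set e := If _ _ _ => Hf.
(* [A n] bounds every accumulator and [K n] the cost of one level of the recursion, both in terms of
   the original input size. *)
pose A n := n + n * (2 * n + 1 + b) ^ b.
pose K n := 100 * (n + A n + 1) + (2 * n + A n + 10 + c) ^ c.
have KP : polyb (fun n => n * K n).
  by rewrite /K /A; polyb.
apply: (@PT_intro _ (e :: tl) _ KP) => y0; move Nn: (dsize y0) => N.
have N1 : dsize y0 <= N by rewrite Nn.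
move El: (dsnd y0) => l; move Eu: (dfst y0) => u.
have LN : dsize l <= N by rewrite -El; apply: leq_trans (dsize_snd _) _.
have UN : dsize u <= N by rewrite -Eu; apply: leq_trans (dsize_fst _) _.
(* The argument shrinks along the induction while [A] and [K] stay evaluated at the fixed size
   [N]. *)
suff [t R L] : exists2 t, runs (e :: tl) y0 (drec (S (dfst u)) (dsnd u) l) t
    & t <= dsize l * K N.
  by exists t => //; apply: leq_trans L _; rewrite leq_mul2r LN orbT.
have ZN := leq_trans (dsize_snd u) UN; have DN := leq_trans (dsize_fst u) UN.
have Asz l' : dsize l' <= N -> dsize (drec (S (dfst u)) (dsnd u) l') <= A N.
  move=> Hl'; apply: leq_trans (@drec_size _ _ _ ((2 * N + 1 + b) ^ b) _) _.
    move=> l2 a h2; apply: leq_trans (Hb (Pair (dfst u) l2) a) _.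
    by rewrite leq_add2l /=; apply: leq_exp; lia.
  by apply: leq_add => //; rewrite leq_mul2r Hl' orbT.
elim: l y0 El Eu LN N1 {Nn Hl} => [n|x _ l IH] y0 El Eu LN N1.
  eexists.
    apply: EvalIf; first by apply: EvalIsPair; apply: EvalSnd; exact: EvalVar.
    by rewrite /= El -Eu /=; apply: EvalSnd; apply: EvalFst; exact: EvalVar.
  rewrite /= El Eu /= /K; move: (A N) => r; move: (_ ^ c) => q.
  rewrite trunc_log0 /=; move: LN => /=; move: (trunc_log _ _) => k.
  by nia.
case: y0 El Eu N1 => [//|u0 l0] /= El Eu N1; subst u0 l0.
have LN' : dsize l <= N by move: LN => /=; lia.
have [||||t R L] := IH (Pair u l) => //.
  by move: N1 => /=; lia.
have [ts Rs Ls] := Hc (Pair (Pair (dfst u) (Pair x l)) (drec (S (dfst u)) (dsnd u) l)).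
have A1 := Asz _ LN; have A2 := Asz _ LN'.
eexists.
  apply: EvalIf; first by apply: EvalIsPair; apply: EvalSnd; exact: EvalVar.
  rewrite /=; apply: Hf Rs; apply: EvalMkPair.
    apply: EvalMkPair; first exact: EvalFst (EvalFst (EvalVar _ _ 0)).
    exact: EvalSnd (EvalVar _ _ 0).
  apply: EvalCall R; apply: EvalMkPair; first exact: EvalFst (EvalVar _ _ 0).
  exact: EvalSnd (EvalSnd (EvalVar _ _ 0)).
have Ls' : ts <= (2 * N + A N + 10 + c) ^ c.
  by apply: leq_trans Ls _; apply: leq_exp; move: LN A2 => /=; lia.
have : t + K N <= dsize (Pair x l) * K N.
  by rewrite /= mulSn mulnDl; lia.
apply: leq_trans; rewrite /K.
move: A1 A2 LN N1 L Ls'; rewrite /= trunc_log1 /=; move: (A N) => r; move: (_ ^ c) => q.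
by lia.
Qed.

Lemma PT_rec S Z L :
  PT (fun y => S (dfst (dfst y)) (dsnd (dfst y)) (dsnd y)) ->
  AG (fun y a => S (dfst y) (dsnd y) a) -> PT Z -> PT L ->
  PT (fun d => drec (S d) (Z d) (L d)).
Proof.
move=> HS HA HZ HL.
exact: PT_comp (PT_rec0 HS HA) (PT_pair (PT_pair PT_id HZ) HL).
Qed.

(** A bound blind to the accumulator, required where a second copy of the accumulator would make the
    growth multiplicative. *)
Definition BD (S : data -> data -> data) : Prop :=
  exists c, forall y a, dsize (S y a) <= (dsize y + c) ^ c.

Lemma BD_intro S q : polyb q -> (forall y a, dsize (S y a) <= q (dsize y)) -> BD S.
Proof. by case=> c Hq H; exists c => y a; apply: leq_trans (H y a) (Hq _). Qed.

Lemma AG_intro S q :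
  polyb q -> (forall y a, dsize (S y a) <= dsize a + q (dsize y)) -> AG S.
Proof.
case=> c Hq H; exists c => y a; apply: leq_trans (H y a) _.
by rewrite leq_add2l.
Qed.

Lemma BD_PT F : PT F -> BD (fun y _ => F y).
Proof. by case/PT_size=> c H; exists c. Qed.

Lemma BD_pair S T : BD S -> BD T -> BD (fun y a => Pair (S y a) (T y a)).
Proof.
case=> b Hb [c Hc]; apply: (@BD_intro _ (fun n => ((n + b) ^ b + (n + c) ^ c).+1)) => [|y a].
  by polyb.
by rewrite /= ltnS leq_add.
Qed.

Lemma BD_if C S T : BD S -> BD T -> BD (fun y a => dif (C y a) (S y a) (T y a)).
Proof.
case=> b Hb [c Hc]; apply: (@BD_intro _ (fun n => (n + b) ^ b + (n + c) ^ c)) => [|y a].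
  by polyb.
by rewrite /dif; case: ifP => _; [apply: leq_trans (Hb y a) _ | apply: leq_trans (Hc y a) _]; lia.
Qed.

Lemma AG_BD S : BD S -> AG S.
Proof. by case=> c H; exists c => y a; apply: leq_trans (H y a) (leq_addl _ _). Qed.

Lemma AG_acc : AG (fun _ a => a).
Proof. by exists 0 => y a; rewrite leq_addr. Qed.

Lemma AG_PT F : PT F -> AG (fun y _ => F y).
Proof. by move=> H; apply/AG_BD/BD_PT. Qed.

Lemma AG_if C S T : AG S -> AG T -> AG (fun y a => dif (C y a) (S y a) (T y a)).
Proof.
case=> b Hb [c Hc]; apply: (@AG_intro _ (fun n => (n + b) ^ b + (n + c) ^ c)) => [|y a].
  by polyb.
by rewrite /dif; case: ifP => _; [apply: leq_trans (Hb y a) _ | apply: leq_trans (Hc y a) _]; lia.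
Qed.

Lemma AG_pairl S T : BD S -> AG T -> AG (fun y a => Pair (S y a) (T y a)).
Proof.
case=> b Hb [c Hc]; apply: (@AG_intro _ (fun n => ((n + b) ^ b + (n + c) ^ c).+1)) => [|y a].
  by polyb.
by have := Hb y a; have := Hc y a => /=; lia.
Qed.

Lemma AG_op o S T : AG S -> BD T -> AG (fun y a => dop o (S y a) (T y a)).
Proof.
case=> b Hb [c Hc]; apply: (@AG_intro _ (fun n => (n + b) ^ b + (n + c) ^ c)) => [|y a].
  by polyb.
by apply: leq_trans (dsize_op _ _ _) _; rewrite addnA; apply: leq_add.
Qed.

(** The outer accumulator enters the inner recursion through its base value, and the inner steps
    only add amounts controlled by [y]. *)
Lemma AG_rec (S : data -> data -> data -> data) (Z : data -> data -> data) L :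
  AG (fun y a => S (dfst y) (dsnd y) a) -> AG Z -> PT L ->
  AG (fun y a => drec (S y) (Z y a) (L y)).
Proof.
case=> b Hb [c Hc] /PT_size [k Hk].
apply: (@AG_intro _ (fun n => (n + c) ^ c + (n + k) ^ k * (n + (n + k) ^ k + 1 + b) ^ b)).
  by polyb.
move=> y a; apply: leq_trans (@drec_size _ _ _ ((dsize y + (dsize y + k) ^ k + 1 + b) ^ b) _) _.
  move=> l' a' Hl'; apply: leq_trans (Hb (Pair y l') a') _; rewrite leq_add2l /=.
  by apply: leq_exp; have := Hk y; lia.
by rewrite addnA leq_add // leq_mul.
Qed.

Lemma PT_app2 g : PT (fun y => g (dfst y) (dsnd y)) ->
  forall F G, PT F -> PT G -> PT (fun d => g (F d) (G d)).
Proof. by move=> Hg F G HF HG; exact: PT_comp Hg (PT_pair HF HG). Qed.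

Lemma PT_app3 g : PT (fun y => g (dfst y) (dfst (dsnd y)) (dsnd (dsnd y))) ->
  forall F G H, PT F -> PT G -> PT H -> PT (fun d => g (F d) (G d) (H d)).
Proof.
by move=> Hg F G H HF HG HH; exact: PT_comp Hg (PT_pair HF (PT_pair HG HH)).
Qed.

Lemma PT_app4 g :
  PT (fun y => g (dfst y) (dfst (dsnd y)) (dfst (dsnd (dsnd y))) (dsnd (dsnd (dsnd y)))) ->
  forall F G H K, PT F -> PT G -> PT H -> PT K ->
  PT (fun d => g (F d) (G d) (H d) (K d)).
Proof.
move=> Hg F G H K HF HG HH HK.
exact: PT_comp Hg (PT_pair HF (PT_pair HG (PT_pair HH HK))).
Qed.

Definition dfold (f : data -> data -> data) (z l : data) : data :=
  drec (fun l' => f (dfst l')) z l.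

Ltac pt_user := fail.

Ltac pt := cbv beta; lazymatch goal with
  | |- PT (fun y => y) => exact: PT_id
  | |- PT dfst => exact: PT_fst0
  | |- PT dsnd => exact: PT_snd0
  | |- PT (fun y => Atom _) => exact: PT_const
  | |- PT (fun y => dfst (@?F y)) => apply: (@PT_fst F); pt
  | |- PT (fun y => dsnd (@?F y)) => apply: (@PT_snd F); pt
  | |- PT (fun y => dispair (@?F y)) => apply: (@PT_ispair F); pt
  | |- PT (fun y => Pair (@?F y) (@?G y)) => apply: (@PT_pair F G); pt
  | |- PT (fun y => dop ?o (@?F y) (@?G y)) => apply: (@PT_op o F G); pt
  | |- PT (fun y => dif (@?F y) (@?G y) (@?H y)) => apply: (@PT_if F G H); pt
  | |- PT (fun y => drec (@?S y) (@?Z y) (@?L y)) => apply: (@PT_rec S Z L); [pt | ag | pt | pt]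
  | |- PT (fun y => dfold (@?S y) (@?Z y) (@?L y)) =>
    rewrite /dfold; pt
  | |- _ => pt_user; pt
  end
with ag := cbv beta; lazymatch goal with
  | |- AG (fun y a => a) => exact: AG_acc
  | |- AG (fun y a => dif (@?F y a) (@?G y a) (@?H y a)) => apply: (@AG_if F G H); ag
  | |- AG (fun y a => Pair (@?F y a) (@?G y a)) => apply: (@AG_pairl F G); [bd | ag]
  | |- AG (fun y a => dop ?o (@?F y a) (@?G y a)) => apply: (@AG_op o F G); [ag | bd]
  | |- AG (fun y a => drec (@?S y) (@?Z y a) (@?L y)) => apply: (@AG_rec S Z L); [ag | ag | pt]
  | |- AG (fun y a => dfold (@?S y) (@?Z y a) (@?L y)) =>
    rewrite /dfold; ag
  | |- AG (fun y a => @?F y) => apply: (@AG_PT F); pt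
  | |- _ => idtac
  end
with bd := cbv beta; lazymatch goal with
  | |- BD (fun y a => @?F y) => apply: (@BD_PT F); pt
  | |- BD (fun y a => Pair (@?F y a) (@?G y a)) => apply: (@BD_pair F G); bd
  | |- BD (fun y a => dif (@?F y a) (@?G y a) (@?H y a)) => apply: (@BD_if F G H); bd
  end.

(** * The algorithm *)

Notation "a +d b" := (dop OpAdd a b) (at level 50, left associativity).
Notation "a *d b" := (dop OpMul a b) (at level 40, left associativity).
Notation "a /d b" := (dop OpDiv a b) (at level 40, left associativity).
Notation "a <=d b" := (dop OpLeq a b) (at level 70).

Definition deq (a b : data) : data := (a <=d b) *d (b <=d a).

Definition dlen (l : data) : data := dfold (fun _ a => a +d Atom 1) (Atom 0) l.

Definition dapp (l1 l2 : data) : data := dfold Pair l2 l1.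

(* A run of the push-relabel procedure is recorded as a log: the list of its
   relabelled machines paired with the list of its moves (job id, new machine),
   latest first.  A machine is a pair (id, capacity), a job is
   (id, (weight, allowed machines)); jobs start on their first machine. *)
Definition dheight (lg v : data) : data :=
  dfold (fun x a => dif (deq x v) (a +d Atom 1) a) (Atom 0) (dfst lg).

Definition dcur (lg j : data) : data :=
  dfold (fun r a => dif (deq (dfst r) (dfst j)) (dsnd r) a)
    (dfst (dsnd (dsnd j))) (dsnd lg).

Definition dload (lg jobs v : data) : data :=
  dfold (fun j a => dif (deq (dcur lg j) v) (a +d dfst (dsnd j)) a) (Atom 0) jobs.

Definition dactive (lg jobs machs : data) : data :=
  dfold (fun m a => dif (dload lg jobs (dfst m) <=d dsnd m) a m) (Atom 0) machs.

Definition dmove (lg jobs v : data) : data :=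
  dfold (fun j a => dif (deq (dcur lg j) v)
    (dfold (fun w a' => dif (dheight lg v <=d dheight lg w) a' (Pair (dfst j) w))
       a (dsnd (dsnd j))) a) (Atom 0) jobs.

Definition dstep (jobs machs lg : data) : data :=
  dif (dispair (dactive lg jobs machs))
    (dif (dispair (dmove lg jobs (dfst (dactive lg jobs machs))))
       (Pair (dfst lg) (Pair (dmove lg jobs (dfst (dactive lg jobs machs))) (dsnd lg)))
       (Pair (Pair (dfst (dactive lg jobs machs)) (dfst lg)) (dsnd lg)))
    lg.

Definition dprod (l1 l2 : data) : data := dfold (fun _ a => dapp l2 a) (Atom 0) l1.

(** The product list is only a counter: its length, [|jobs| + 1] times [|machs| ^ 2], is the initial
    value of the potential [measure]. *)
Definition drun (jobs machs : data) : data :=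
  dfold (fun _ lg => dstep jobs machs lg) (Pair (Atom 0) (Atom 0))
    (dprod (Pair (Atom 0) jobs) (dprod machs machs)).

(* An edge is represented as (index, ((end, end), integer weight)). *)
Definition eend1 (e : data) : data := dfst (dfst (dsnd e)).
Definition eend2 (e : data) : data := dsnd (dfst (dsnd e)).
Definition ewt (e : data) : data := dsnd (dsnd e).

(** A common denominator of all weights, used by [dedges] to make them integers. *)
Definition dden (E : data) : data := dfold (fun e a => a *d dsnd (dsnd e)) (Atom 1) E.

(** The index of an edge is the number of edges after it, which the recursion can read off the
    remaining list. *)
Definition dedges (E : data) : data :=
  drec (fun l a => Pair (Pair (dlen (dsnd l)) (Pair (dfst (dfst l))
    (dfst (dsnd (dfst l)) *d (dden E /d dsnd (dsnd (dfst l)))))) a) (Atom 0) E.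

Definition dmaxw (E : data) : data :=
  dfold (fun e a => dif (a <=d ewt e) (ewt e) a) (Atom 0) E.

Definition dminw (E : data) : data :=
  dfold (fun e a => dif (a <=d ewt e) a (ewt e)) (dmaxw E) E.

(** The dummy entry in front yields the [|E| + 1] values [|E|, ..., 0]. *)
Definition drange (E : data) : data :=
  drec (fun l a => Pair (dlen (dsnd l)) a) (Atom 0) (Pair (Atom 0) E).

Definition ejob (e w : data) : data :=
  Pair (dfst e) (Pair w (Pair (eend1 e) (Pair (eend2 e) (Atom 0)))).

Definition ejobs (E : data) : data :=
  dfold (fun e a => Pair (ejob e (ewt e)) a) (Atom 0) E.

Definition emachs (V U : data) : data :=
  dfold (fun v a => Pair (Pair v U) a) (Atom 0) V.

(* [dcur] need not return an atom on arbitrary data; adding [Atom 0] makes it one. *)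
Definition candA (V E U : data) : data :=
  dfold (fun e a =>
    Pair (Pair (dcur (drun (ejobs E) (emachs V U)) (ejob e (ewt e)) +d Atom 0) (ewt e)) a)
    (Atom 0) E.

(* In the fractional relaxation, the vertex v becomes the machines 2v
   and 2v+1; every big edge is cut into [g] unit jobs, which may only use the
   even machines of its ends. *)
Definition mach0 (v : data) : data := Atom 2 *d v.
Definition mach1 (v : data) : data := Atom 2 *d v +d Atom 1.

Definition smalljob (e : data) : data :=
  Pair (dfst e) (Pair (Atom 1) (Pair (mach0 (eend1 e)) (Pair (mach1 (eend1 e))
    (Pair (mach0 (eend2 e)) (Pair (mach1 (eend2 e)) (Atom 0)))))).

(** With [M] the number of edges, the identifier [t * M + index] separates the tokens from each
    other and from the small jobs, whose identifiers are plain indices. *)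
Definition tokenjob (M e t : data) : data :=
  Pair (t *d M +d dfst e) (Pair (Atom 1)
    (Pair (mach0 (eend1 e)) (Pair (mach0 (eend2 e)) (Atom 0)))).

Definition fjobs (E b g : data) : data :=
  dfold (fun e a => dif (b <=d ewt e)
    (dfold (fun t a' => dif (t +d Atom 1 <=d g) (Pair (tokenjob (dlen E) e t) a') a')
      a (drange E))
    (Pair (smalljob e) a)) (Atom 0) E.

Definition fmachs (V g h : data) : data :=
  dfold (fun v a => Pair (Pair (mach0 v) g) (Pair (Pair (mach1 v) h) a)) (Atom 0) V.

Definition frun (V E b gh : data) : data :=
  drun (fjobs E b (dfst gh)) (fmachs V (dfst gh) (dsnd gh)).

Definition extra (lg E b v : data) : data :=
  dfold (fun e a => dif (b <=d ewt e) a
    (dif (deq (dcur lg (smalljob e)) (mach0 v)) (a +d Atom 1) a)) (Atom 0) E.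

Definition bigjobs (E b : data) : data :=
  dfold (fun e a => dif (b <=d ewt e) (Pair (ejob e (Atom 1)) a) a) (Atom 0) E.

Definition bigmachs (V E b gh : data) : data :=
  dfold (fun v a => Pair (Pair v
    (dif (Atom 2 *d extra (frun V E b gh) E b v <=d dfst gh) (Atom 1) (Atom 0))) a)
    (Atom 0) V.

Definition bigrun (V E b gh : data) : data := drun (bigjobs E b) (bigmachs V E b gh).

(** Machines [2v] and [2v+1] both stand for [v], so halving recovers the head of a small edge. *)
Definition candB (V E b gh : data) : data :=
  dfold (fun e a => Pair (Pair (dif (b <=d ewt e)
      (dcur (bigrun V E b gh) (ejob e (Atom 1)) +d Atom 0)
      (dcur (frun V E b gh) (smalljob e) /d Atom 2)) (ewt e)) a)
    (Atom 0) E.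

Definition cload (c v : data) : data :=
  dfold (fun x a => dif (deq (dfst x) v) (a +d dsnd x) a) (Atom 0) c.

Definition cmakespan (V c : data) : data :=
  dfold (fun v a => dif (a <=d cload c v) (cload c v) a) (Atom 0) V.

Definition better (V c a : data) : data := dif (cmakespan V c <=d cmakespan V a) c a.

(** For [candA] the pair [(i, j)] guesses the optimum as the load of a vertex with [i] small and [j]
    big edges; for [candB] it guesses [g] and [h]. *)
Definition cands (V E : data) : data :=
  dfold (fun i a => dfold (fun j a' =>
      Pair (candA V E (i *d dminw E +d j *d dmaxw E +d dmaxw E))
        (Pair (candB V E (dmaxw E) (Pair i j)) a')) a (drange E))
    (Atom 0) (drange E).

Definition cand0 (E : data) : data :=
  dfold (fun e a => Pair (Pair (eend1 e) (ewt e)) a) (Atom 0) E.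

Definition best (V E : data) : data := dfold (better V) (cand0 E) (cands V E).

Definition balance (d : data) : data :=
  dfold (fun x a => Pair (dfst x) a) (Atom 0) (best (dfst d) (dedges (dsnd d))).

(** * Polynomial cost of the functions of the algorithm *)

Lemma PT2_deq : PT (fun y => deq (dfst y) (dsnd y)).
Proof. rewrite /deq; pt. Qed.

Ltac pt_user ::= lazymatch goal with
  | |- PT (fun y => deq (@?F y) (@?G y)) => apply: (PT_app2 PT2_deq (F := F) (G := G))
  end.

Lemma PT1_dlen : PT dlen.
Proof. rewrite /dlen; pt. Qed.

Lemma PT2_dapp : PT (fun y => dapp (dfst y) (dsnd y)).
Proof. rewrite /dapp; pt. Qed.

Lemma PT2_dheight : PT (fun y => dheight (dfst y) (dsnd y)).
Proof. rewrite /dheight; pt. Qed.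

Lemma PT2_dcur : PT (fun y => dcur (dfst y) (dsnd y)).
Proof. rewrite /dcur; pt. Qed.

Ltac pt_user ::= lazymatch goal with
  | |- PT (fun y => deq (@?F y) (@?G y)) => apply: (PT_app2 PT2_deq (F := F) (G := G))
  | |- PT (fun y => dlen (@?F y)) => apply: (PT_comp PT1_dlen (G := F))
  | |- PT (fun y => dapp (@?F y) (@?G y)) => apply: (PT_app2 PT2_dapp (F := F) (G := G))
  | |- PT (fun y => dheight (@?F y) (@?G y)) =>
    apply: (PT_app2 PT2_dheight (F := F) (G := G))
  | |- PT (fun y => dcur (@?F y) (@?G y)) => apply: (PT_app2 PT2_dcur (F := F) (G := G))
  end.

Lemma PT3_dload : PT (fun y => dload (dfst y) (dfst (dsnd y)) (dsnd (dsnd y))).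
Proof. rewrite /dload; pt. Qed.

Lemma PT3_dmove : PT (fun y => dmove (dfst y) (dfst (dsnd y)) (dsnd (dsnd y))).
Proof. rewrite /dmove; pt. Qed.

Lemma PT2_dprod : PT (fun y => dprod (dfst y) (dsnd y)).
Proof.
rewrite /dprod; apply: PT_rec; [pt | | pt | pt].
rewrite /dapp; ag.
Qed.

Ltac pt_user ::= lazymatch goal with
  | |- PT (fun y => deq (@?F y) (@?G y)) => apply: (PT_app2 PT2_deq (F := F) (G := G))
  | |- PT (fun y => dlen (@?F y)) => apply: (PT_comp PT1_dlen (G := F))
  | |- PT (fun y => dheight (@?F y) (@?G y)) =>
    apply: (PT_app2 PT2_dheight (F := F) (G := G))
  | |- PT (fun y => dcur (@?F y) (@?G y)) => apply: (PT_app2 PT2_dcur (F := F) (G := G))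
  | |- PT (fun y => dprod (@?F y) (@?G y)) => apply: (PT_app2 PT2_dprod (F := F) (G := G))
  | |- PT (fun y => dload (@?F y) (@?G y) (@?H y)) =>
    apply: (PT_app3 PT3_dload (F := F) (G := G) (H := H))
  | |- PT (fun y => dmove (@?F y) (@?G y) (@?H y)) =>
    apply: (PT_app3 PT3_dmove (F := F) (G := G) (H := H))
  end.

Lemma PT3_dactive : PT (fun y => dactive (dfst y) (dfst (dsnd y)) (dsnd (dsnd y))).
Proof.
rewrite /dactive; apply: PT_rec; [pt | | pt | pt].
apply: AG_if; [exact: AG_acc | ag].
Qed.

Lemma drec_inv (P : data -> Prop) f z l :
  P z -> (forall l' a, dsize l' <= dsize l -> P a -> P (f l' a)) -> P (drec f z l).
Proof.
move=> Pz; elim: l => [n|x _ l IH] H //=; apply: (H) => //; apply: IH => l' a Hl'.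
by apply: H; apply: leq_trans Hl' _; rewrite /=; lia.
Qed.

Lemma dsize_dactive lg js ms : dsize (dactive lg js ms) <= dsize ms.
Proof.
apply: (drec_inv (P := fun d => dsize d <= _)) => [|l a Hl Ha].
  by rewrite (dsize_bool false) dsize_gt0.
by rewrite /dif; case: ifP => // _; apply: leq_trans (dsize_fst l) Hl.
Qed.

Lemma dsize_dmove lg js v : dsize (dmove lg js v) <= (dsize js + dsize js).+1.
Proof.
apply: (drec_inv (P := fun d => dsize d <= _)) => [|l a Hl Ha].
  by rewrite (dsize_bool false).
rewrite /dif; case: ifP => // _.
apply: (drec_inv (P := fun d => dsize d <= _)) => // l' a' Hl' Ha'.
case: ifP => //= _; rewrite ltnS leq_add //.
  by apply: leq_trans (dsize_fst _) (leq_trans (dsize_fst _) Hl).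
apply: leq_trans (dsize_fst _) (leq_trans Hl' _).
apply: leq_trans (dsize_snd _) (leq_trans (dsize_snd _) _).
exact: leq_trans (dsize_fst _) Hl.
Qed.

(** The entry added to the log is computed from the log, so the closure rules for growth do not give
    this bound; but it is copied from [js] or [ms], whose sizes control it. *)
Lemma dsize_dstep js ms lg :
  dsize (dstep js ms lg) <= dsize lg + (2 * dsize js + dsize ms + 4).
Proof.
have Hp : dsize (dfst lg) + dsize (dsnd lg) <= (dsize lg).+1.
  by case: lg => [n|a b] /=; rewrite ?trunc_log0 //; lia.
have Ha := dsize_dactive lg js ms; have Hf := dsize_fst (dactive lg js ms).
have Hm := dsize_dmove lg js (dfst (dactive lg js ms)).
by rewrite /dstep /dif; case: ifP => _; [case: ifP => _ /=; lia | lia].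
Qed.

Lemma PT2_drun : PT (fun y => drun (dfst y) (dsnd y)).
Proof.
rewrite /drun; apply: PT_rec; [| |pt|pt].
  rewrite /dstep; pose act y := dactive (dsnd y) (dfst (dfst (dfst y))) (dsnd (dfst (dfst y))).
  have Hact : PT act by apply: (PT_app3 PT3_dactive); pt.
  pose mv y := dmove (dsnd y) (dfst (dfst (dfst y))) (dfst (act y)).
  have Hmv : PT mv by apply: (PT_app3 PT3_dmove); [pt|pt|exact: PT_fst].
  apply: (PT_if (F := fun y => dispair (act y))); first exact: PT_ispair.
    apply: (PT_if (F := fun y => dispair (mv y))); first exact: PT_ispair.
      by apply: PT_pair; [pt | apply: (PT_pair (F := mv)); [exact: Hmv | pt]].
    apply: PT_pair; last pt.
    by apply: PT_pair; [exact: (PT_fst (F := act)) | pt].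
  pt.
apply: (@AG_intro _ (fun n => 3 * n + 4)) => [|y a]; first by polyb.
apply: leq_trans (dsize_dstep _ _ _) _; rewrite leq_add2l.
have := dsize_fst (dfst y); have := dsize_snd (dfst y); have := dsize_fst y.
by lia.
Qed.

Ltac pt_user ::= lazymatch goal with
  | |- PT (fun y => deq (@?F y) (@?G y)) => apply: (PT_app2 PT2_deq (F := F) (G := G))
  | |- PT (fun y => dlen (@?F y)) => apply: (PT_comp PT1_dlen (G := F))
  | |- PT (fun y => dcur (@?F y) (@?G y)) => apply: (PT_app2 PT2_dcur (F := F) (G := G))
  | |- PT (fun y => drun (@?F y) (@?G y)) => apply: (PT_app2 PT2_drun (F := F) (G := G))
  | |- PT (fun y => dden (@?F y)) => rewrite /dden
  | |- PT (fun y => ejob (@?F y) (@?G y)) => rewrite /ejob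
  | |- PT (fun y => ewt (@?F y)) => rewrite /ewt
  | |- PT (fun y => eend1 (@?F y)) => rewrite /eend1
  | |- PT (fun y => eend2 (@?F y)) => rewrite /eend2
  | |- PT (fun y => mach0 (@?F y)) => rewrite /mach0
  | |- PT (fun y => mach1 (@?F y)) => rewrite /mach1
  | |- PT (fun y => ejobs (@?F y)) => rewrite /ejobs
  | |- PT (fun y => emachs (@?F y) (@?G y)) => rewrite /emachs
  | |- PT (fun y => smalljob (@?F y)) => rewrite /smalljob
  | |- PT (fun y => tokenjob (@?F y) (@?G y) (@?H y)) => rewrite /tokenjob
  | |- PT (fun y => drange (@?F y)) => rewrite /drange
  | |- PT (fun y => bigjobs (@?F y) (@?G y)) => rewrite /bigjobs
  | |- PT (fun y => cload (@?F y) (@?G y)) => rewrite /cload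
  | |- PT (fun y => dmaxw (@?F y)) => rewrite /dmaxw
  | |- PT (fun y => dminw (@?F y)) => rewrite /dminw
  end.

Lemma PT1_dedges : PT dedges.
Proof. rewrite /dedges; pt. Qed.

Lemma PT3_candA : PT (fun y => candA (dfst y) (dfst (dsnd y)) (dsnd (dsnd y))).
Proof. rewrite /candA; pt. Qed.

Lemma PT4_frun : PT (fun y => frun (dfst y) (dfst (dsnd y)) (dfst (dsnd (dsnd y)))
  (dsnd (dsnd (dsnd y)))).
Proof.
rewrite /frun; apply: (PT_app2 PT2_drun); rewrite /fjobs /fmachs; pt.
Qed.

Lemma PT4_extra : PT (fun y => extra (dfst y) (dfst (dsnd y)) (dfst (dsnd (dsnd y)))
  (dsnd (dsnd (dsnd y)))).
Proof. rewrite /extra; pt. Qed.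

Ltac pt_user ::= lazymatch goal with
  | |- PT (fun y => dcur (@?F y) (@?G y)) => apply: (PT_app2 PT2_dcur (F := F) (G := G))
  | |- PT (fun y => drun (@?F y) (@?G y)) => apply: (PT_app2 PT2_drun (F := F) (G := G))
  | |- PT (fun y => frun (@?F y) (@?G y) (@?H y) (@?K y)) =>
    apply: (PT_app4 PT4_frun (F := F) (G := G) (H := H) (K := K))
  | |- PT (fun y => extra (@?F y) (@?G y) (@?H y) (@?K y)) =>
    apply: (PT_app4 PT4_extra (F := F) (G := G) (H := H) (K := K))
  | |- PT (fun y => ejob (@?F y) (@?G y)) => rewrite /ejob
  | |- PT (fun y => ewt (@?F y)) => rewrite /ewt
  | |- PT (fun y => eend1 (@?F y)) => rewrite /eend1
  | |- PT (fun y => eend2 (@?F y)) => rewrite /eend2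
  | |- PT (fun y => mach0 (@?F y)) => rewrite /mach0
  | |- PT (fun y => mach1 (@?F y)) => rewrite /mach1
  | |- PT (fun y => smalljob (@?F y)) => rewrite /smalljob
  end.

Lemma PT4_bigrun : PT (fun y => bigrun (dfst y) (dfst (dsnd y)) (dfst (dsnd (dsnd y)))
  (dsnd (dsnd (dsnd y)))).
Proof. rewrite /bigrun /bigjobs /bigmachs; pt. Qed.

Ltac pt_user ::= lazymatch goal with
  | |- PT (fun y => deq (@?F y) (@?G y)) => apply: (PT_app2 PT2_deq (F := F) (G := G))
  | |- PT (fun y => dlen (@?F y)) => apply: (PT_comp PT1_dlen (G := F))
  | |- PT (fun y => dcur (@?F y) (@?G y)) => apply: (PT_app2 PT2_dcur (F := F) (G := G))
  | |- PT (fun y => frun (@?F y) (@?G y) (@?H y) (@?K y)) =>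
    apply: (PT_app4 PT4_frun (F := F) (G := G) (H := H) (K := K))
  | |- PT (fun y => bigrun (@?F y) (@?G y) (@?H y) (@?K y)) =>
    apply: (PT_app4 PT4_bigrun (F := F) (G := G) (H := H) (K := K))
  | |- PT (fun y => ejob (@?F y) (@?G y)) => rewrite /ejob
  | |- PT (fun y => ewt (@?F y)) => rewrite /ewt
  | |- PT (fun y => eend1 (@?F y)) => rewrite /eend1
  | |- PT (fun y => eend2 (@?F y)) => rewrite /eend2
  | |- PT (fun y => mach0 (@?F y)) => rewrite /mach0
  | |- PT (fun y => mach1 (@?F y)) => rewrite /mach1
  | |- PT (fun y => smalljob (@?F y)) => rewrite /smalljob
  | |- PT (fun y => cload (@?F y) (@?G y)) => rewrite /cload
  end.

Lemma PT4_candB : PT (fun y => candB (dfst y) (dfst (dsnd y)) (dfst (dsnd (dsnd y)))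
  (dsnd (dsnd (dsnd y)))).
Proof. rewrite /candB; pt. Qed.

Lemma PT2_cmakespan : PT (fun y => cmakespan (dfst y) (dsnd y)).
Proof. rewrite /cmakespan; pt. Qed.

Ltac pt_user ::= lazymatch goal with
  | |- PT (fun y => dlen (@?F y)) => apply: (PT_comp PT1_dlen (G := F))
  | |- PT (fun y => dedges (@?F y)) => apply: (PT_comp PT1_dedges (G := F))
  | |- PT (fun y => candA (@?F y) (@?G y) (@?H y)) =>
    apply: (PT_app3 PT3_candA (F := F) (G := G) (H := H))
  | |- PT (fun y => candB (@?F y) (@?G y) (@?H y) (@?K y)) =>
    apply: (PT_app4 PT4_candB (F := F) (G := G) (H := H) (K := K))
  | |- PT (fun y => cmakespan (@?F y) (@?G y)) =>
    apply: (PT_app2 PT2_cmakespan (F := F) (G := G))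
  | |- PT (fun y => ewt (@?F y)) => rewrite /ewt
  | |- PT (fun y => eend1 (@?F y)) => rewrite /eend1
  | |- PT (fun y => drange (@?F y)) => rewrite /drange
  | |- PT (fun y => dmaxw (@?F y)) => rewrite /dmaxw
  | |- PT (fun y => dminw (@?F y)) => rewrite /dminw
  end.

Lemma PT2_best : PT (fun y => best (dfst y) (dsnd y)).
Proof. rewrite /best /better /cand0 /cands; pt. Qed.

Lemma PT_balance : PT balance.
Proof.
rewrite /balance; apply: PT_rec; [pt | ag | pt |].
by apply: (PT_app2 PT2_best); pt.
Qed.
(** * Correctness of the push-relabel procedure *)

Lemma data_eq_dec (a b : data) : {a = b} + {a <> b}.
Proof. by decide equality; exact: eq_comparable. Qed.

HB.instance Definition _ := hasDecEq.Build data (compareP data_eq_dec).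

Fixpoint dlist (l : data) : seq data := if l is Pair x l' then x :: dlist l' else [::].

Lemma dfoldE f z l : dfold f z l = foldr f z (dlist l).
Proof. by rewrite /dfold; elim: l => //= x _ l ->. Qed.

Lemma dlist_app l1 l2 : dlist (dapp l1 l2) = dlist l1 ++ dlist l2.
Proof. by rewrite /dapp dfoldE; elim: (dlist l1) => //= x s ->. Qed.

Lemma dlenE l : dlen l = Atom (size (dlist l)).
Proof. by rewrite /dlen dfoldE; elim: (dlist l) => //= x s ->; rewrite /dop /= addn1. Qed.

Lemma size_dprod l1 l2 : size (dlist (dprod l1 l2)) = size (dlist l1) * size (dlist l2).
Proof.
rewrite /dprod dfoldE; elim: (dlist l1) => //= x s IH.
by rewrite dlist_app size_cat IH mulSn.
Qed.

Lemma deqE a b : deq a b = Atom (dnat a == dnat b).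
Proof. by rewrite /deq /dop /= mulnb -eqn_leq. Qed.

Lemma difE (c : bool) a b : dif (Atom c) a b = if c then a else b.
Proof. by case: c. Qed.

Lemma dfold_sum (P : pred data) (F : data -> nat) l :
  dfold (fun j a => if P j then a +d Atom (F j) else a) (Atom 0) l =
  Atom (\sum_(j <- dlist l | P j) F j).
Proof.
rewrite dfoldE; elim: (dlist l) => [|j s IH] /=; first by rewrite big_nil.
by rewrite big_cons IH; case: ifP => // _; rewrite /dop /= addnC.
Qed.

Definition jid (j : data) : nat := dnat (dfst j).
Definition jwt (j : data) : nat := dnat (dfst (dsnd j)).
Definition jal (j : data) : seq nat := map dnat (dlist (dsnd (dsnd j))).
Definition mid (m : data) : nat := dnat (dfst m).
Definition mcap (m : data) : nat := dnat (dsnd m).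

Definition hgt (lg : data) (v : nat) : nat := count (fun x => dnat x == v) (dlist (dfst lg)).
Definition cur (lg j : data) : nat := dnat (dcur lg j).
Definition load (lg : data) (js : seq data) (v : nat) : nat :=
  \sum_(j <- js | cur lg j == v) jwt j.

Lemma dheightE lg v : dheight lg v = Atom (hgt lg (dnat v)).
Proof.
rewrite /dheight dfoldE /hgt; elim: (dlist _) => //= x s ->.
by rewrite deqE difE; case: eqP => _ //=; rewrite /dop /= addn1.
Qed.

Lemma dloadE lg js v : dload lg js v = Atom (load lg (dlist js) (dnat v)).
Proof.
rewrite /load -(dfold_sum (fun j => cur lg j == dnat v)) /dload !dfoldE.
elim: (dlist _) => //= x s ->.
by rewrite deqE difE; case: eqP.
Qed.

(** Machines are pairs, so a result that is no pair signals that no machine is overloaded. *)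
Lemma dactiveP lg js ms : all is_pair (dlist ms) ->
  if is_pair (dactive lg js ms) then
    dactive lg js ms \in dlist ms /\
    mcap (dactive lg js ms) < load lg (dlist js) (mid (dactive lg js ms))
  else forall m, m \in dlist ms -> load lg (dlist js) (mid m) <= mcap m.
Proof.
rewrite /dactive dfoldE; elim: (dlist ms) => //= m s IH /andP[pm ps].
rewrite dloadE /dop /= -/(mid m) -/(mcap m) difE.
case: (leqP (load lg (dlist js) (mid m)) (mcap m)) => Hm; last by rewrite pm mem_head.
have := IH ps; case: ifP => _; first by case=> H1 H2; rewrite in_cons H1 orbT.
by move=> H x; rewrite in_cons => /orP[/eqP-> //|]; apply: H.
Qed.

Lemma dmoveP lg js v :
  if is_pair (dmove lg js v) then
    exists j w, [/\ j \in dlist js, dmove lg js v = Pair (dfst j) w, cur lg j = dnat v,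
      dnat w \in jal j & hgt lg (dnat w) < hgt lg (dnat v)]
  else forall j w, j \in dlist js -> cur lg j = dnat v -> w \in jal j ->
    hgt lg (dnat v) <= hgt lg w.
Proof.
rewrite /dmove dfoldE; elim: (dlist js) => //= j s; set D := foldr _ _ _ => IH.
have IHP : is_pair D -> exists j' w, [/\ j' \in j :: s, D = Pair (dfst j') w,
    cur lg j' = dnat v, dnat w \in jal j' & hgt lg (dnat w) < hgt lg (dnat v)].
  move=> pD; move: IH; rewrite pD => -[j' [w [H1 H2 H3 H4 H5]]].
  by exists j', w; split=> //; rewrite in_cons H1 orbT.
rewrite deqE difE -/(cur lg j); case: eqP => [Ej|Nj]; last first.
  case: ifP => pD; first exact: IHP.
  move: IH; rewrite pD => IH j' w; rewrite in_cons => /orP[/eqP-> //|]; exact: IH.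
rewrite dfoldE.
(* The inner scan is generalised over the list [ws] of allowed machines; its starting value [D] is
   the result for the remaining jobs. *)
suff H ws : let D' := foldr (fun w a' =>
      dif (dheight lg v <=d dheight lg w) a' (Pair (dfst j) w)) D ws in
    if is_pair D' then D' = D \/
      exists w, [/\ D' = Pair (dfst j) w, w \in ws & hgt lg (dnat w) < hgt lg (dnat v)]
    else is_pair D = false /\ forall w, w \in ws -> hgt lg (dnat v) <= hgt lg (dnat w).
  move: (H (dlist (dsnd (dsnd j)))) => /=; case: ifP => pD'.
    case=> [ED|[w [E1 E2 E3]]]; first by rewrite ED; apply: IHP; rewrite -ED.
    by exists j, w; split=> //; [exact: mem_head | exact: map_f].
  case=> pD Hw j' w; rewrite in_cons => /orP[/eqP->|Hj'] Hc.
    by case/mapP=> w' Hw' ->; apply: Hw.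
  by move: IH; rewrite pD => IH; apply: IH.
elim: ws => [|w ws] /=; first by case: ifP => // _; left.
set D' := foldr _ _ ws => IHw.
rewrite !dheightE /dop /= difE; case: leqP => Hw.
  move: IHw; case: ifP => _.
    by case=> [ED|[w' [E1 E2 E3]]]; [left|right; exists w'; rewrite in_cons E2 orbT].
  by case=> pD H; split=> // w'; rewrite in_cons => /orP[/eqP-> //|]; apply: H.
by right; exists w; rewrite mem_head.
Qed.

Lemma cur_move lg a w j :
  cur (Pair (dfst lg) (Pair (Pair a w) (dsnd lg))) j =
  if dnat a == jid j then dnat w else cur lg j.
Proof. by rewrite /cur /dcur !dfoldE /= deqE difE -/(jid j); case: eqP. Qed.

Lemma uniq_map_inj (T U : eqType) (f : T -> U) s :
  uniq (map f s) -> {in s &, injective f}.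
Proof.
elim: s => //= x s IH /andP[nx us] a b; rewrite !in_cons.
case/orP=> [/eqP->|Ha]; case/orP=> [/eqP->|Hb] // E; last exact: IH.
  by move: nx; rewrite E map_f.
by move: nx; rewrite -E map_f.
Qed.

Lemma drun_iter js ms :
  drun js ms = iter ((size (dlist js)).+1 * size (dlist ms) ^ 2) (dstep js ms)
    (Pair (Atom 0) (Atom 0)).
Proof.
rewrite /drun dfoldE -mulnn -!size_dprod.
have -> : (size (dlist js)).+1 = size (dlist (Pair (Atom 0) js)) by [].
by rewrite -size_dprod; elim: (dlist (dprod _ _)) => //= x s ->.
Qed.

Definition legal js lg : Prop := forall j, j \in dlist js -> cur lg j \in jal j.

Lemma legal0 js : (forall j, j \in dlist js -> jal j != [::]) -> legal js (Pair (Atom 0) (Atom 0)).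
Proof.
move=> H j /H; rewrite /jal /cur /dcur /=.
by case: (dsnd (dsnd j)) => //= x l _; rewrite mem_head.
Qed.

(** Uniqueness of identifiers matters because a move in the log affects every job that carries the
    given identifier. *)
Lemma legal_step js ms lg :
  uniq (map jid (dlist js)) -> legal js lg -> legal js (dstep js ms lg).
Proof.
move=> ujs Hl; rewrite /dstep /dispair !difE; case: ifP => // _.
have := dmoveP lg js (dfst (dactive lg js ms)); case: ifP => _ //.
case=> j [w [Hj -> _ Hw _]] j' Hj'; rewrite cur_move.
case: eqP => [E|_]; last exact: Hl.
by rewrite -(uniq_map_inj ujs Hj Hj' E).
Qed.

Lemma legal_drun js ms :
  uniq (map jid (dlist js)) -> (forall j, j \in dlist js -> jal j != [::]) ->
  legal js (drun js ms).
Proof.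
move=> ujs /legal0 H0; rewrite drun_iter; elim: (_ * _) => //= k.
exact: legal_step.
Qed.

Lemma leq_sum_seq (T : eqType) (s : seq T) (P : pred T) (F G : T -> nat) :
  (forall j, j \in s -> P j -> F j <= G j) ->
  \sum_(j <- s | P j) F j <= \sum_(j <- s | P j) G j.
Proof.
move=> H; rewrite big_seq_cond [X in _ <= X]big_seq_cond.
by apply: leq_sum => j /andP[/H].
Qed.

Lemma ltn_sum_seq (T : eqType) (s : seq T) (P : pred T) (F G : T -> nat) i :
  (forall j, j \in s -> P j -> F j <= G j) -> i \in s -> P i -> F i < G i ->
  \sum_(j <- s | P j) F j < \sum_(j <- s | P j) G j.
Proof.
move=> H Hi Pi Hlt; rewrite !(big_rem i Hi) /= Pi -addSn leq_add //.
by apply: leq_sum_seq => j /mem_rem; apply: H.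
Qed.

Lemma leq_sum_pred (T : eqType) (s : seq T) (P Q : pred T) (F : T -> nat) :
  (forall j, j \in s -> P j -> Q j) ->
  \sum_(j <- s | P j) F j <= \sum_(j <- s | Q j) F j.
Proof.
move=> H; rewrite big_mkcond [X in _ <= X]big_mkcond.
by apply: leq_sum_seq => j /H {}H _; case: ifP => // /H ->.
Qed.

Lemma sum_fibers (T : eqType) (s : seq T) (f : T -> nat) (w : T -> nat) (R : pred nat) vs :
  uniq vs ->
  \sum_(v <- vs | R v) \sum_(j <- s | f j == v) w j <= \sum_(j <- s | R (f j)) w j.
Proof.
move=> uvs; rewrite (exchange_big_dep (fun j => R (f j))) /=; last by move=> v j Rv /eqP->.
apply: leq_sum_seq => j _ _; rewrite big_const_seq iter_addn_0 -[X in _ <= X]muln1.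
rewrite leq_mul2l; apply/orP; right.
apply: (@leq_trans (count_mem (f j) vs)); last by rewrite count_uniq_mem // leq_b1.
by apply: sub_count => v /andP[_ /eqP->] /=.
Qed.

Section PushRelabel.

(** [L] is the load below which a machine of positive height never falls: by [L_job] an overloaded
    machine can give up any one job and keep [L], and by [hall] the jobs confined to a set of
    machines fit within its total [L]. *)
Variables (jobs machs : data) (L : nat -> nat).
Let js := dlist jobs.
Let ms := dlist machs.
Let vs := map mid ms.

Hypotheses (js_uniq : uniq (map jid js)) (ms_uniq : uniq vs) (ms_pair : all is_pair ms).
Hypothesis jal_neq0 : forall j, j \in js -> jal j != [::].
Hypothesis jal_sub : forall j, j \in js -> {subset jal j <= vs}.
Hypothesis L_cap : forall m, m \in ms -> L (mid m) <= mcap m.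
Hypothesis L_job :
  forall m j, m \in ms -> j \in js -> L (mid m) + jwt j <= (mcap m).+1.
Hypothesis hall : forall R : pred nat,
  \sum_(j <- js | all R (jal j)) jwt j <= \sum_(v <- vs | R v) L v.

(** The second clause is the usual validity of push-relabel labels: along a job the height drops by
    at most one level. *)
Definition pr_inv lg : Prop :=
  [/\ legal jobs lg,
      forall j w, j \in js -> w \in jal j -> hgt lg (cur lg j) <= (hgt lg w).+1,
      forall v, v \in vs -> 0 < hgt lg v -> L v <= load lg js v
    & forall v, v \in vs -> hgt lg v <= size ms].

(** A move lowers the first sum. A relabelling raises it by at most [size js] and lowers the second
    sum, hence the factor [(size js).+1]. *)
Definition measure lg : nat :=
  \sum_(j <- js) hgt lg (cur lg j) + (size js).+1 * \sum_(v <- vs) (size ms - hgt lg v).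

(* If an active machine had height at least [size ms], some level k below would
   be empty; the machines above level k then violate Hall's condition. *)
Lemma active_low lg m :
  pr_inv lg -> m \in ms -> mcap m < load lg js (mid m) -> hgt lg (mid m) < size ms.
Proof.
move=> [I1 I2 I3 I4] mm act; rewrite ltnNge; apply/negP => Hh.
have vm : mid m \in vs by apply: map_f.
have sv : size vs = size ms by rewrite size_map.
have [k kn Hk] : exists2 k, k < size ms & k \notin map (hgt lg) vs.
  case E : (all (fun k => k \in map (hgt lg) vs) (iota 0 (size ms))); last first.
    by move/negbT: E => /allPn[k]; rewrite mem_iota => Hk ?; exists k.
  (* The machine [m] lies at height [size ms] or more, so only [size ms - 1] machines remain to
     occupy the [size ms] lower levels. *)
  have : {subset iota 0 (size ms) <= map (hgt lg) (rem (mid m) vs)}.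
    move=> k Hk; have /mapP[v vv Ek] := allP E k Hk.
    rewrite Ek map_f // mem_rem_uniq // inE vv andbT.
    apply/eqP => Ev; move: Hk; rewrite mem_iota Ek Ev; lia.
  move/(uniq_leq_size (iota_uniq _ _)); rewrite size_iota size_map size_rem // sv.
  have : 0 < size vs by case: (vs) vm.
  by rewrite sv; lia.
pose R v := k < hgt lg v.
have Rm : R (mid m) by apply: leq_trans kn Hh.
have H1 : \sum_(v <- vs | R v) L v < \sum_(v <- vs | R v) load lg js v.
  apply: (ltn_sum_seq (i := mid m)) => // [v vv Rv|].
    by apply: I3 => //; apply: leq_ltn_trans Rv.
  exact: leq_ltn_trans (L_cap mm) act.
have H2 := sum_fibers js (cur lg) jwt R ms_uniq.
suff H3 : \sum_(j <- js | R (cur lg j)) jwt j <= \sum_(j <- js | all R (jal j)) jwt j.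
  by have := leq_trans H1 (leq_trans H2 (leq_trans H3 (hall R))); rewrite ltnn.
(* A job above level [k] has its allowed machines at level [k] or higher, and level [k] is empty. *)
apply: leq_sum_pred => j Hj Rj; apply/allP => w Hw; rewrite /R ltn_neqAle.
have vw := jal_sub Hj Hw; rewrite (contraNneq _ Hk) => [|->]; last exact: map_f.
by rewrite -ltnS; apply: leq_trans (I2 j w Hj Hw).
Qed.

Lemma pr_step lg : pr_inv lg ->
  pr_inv (dstep jobs machs lg) /\
  ((forall m, m \in ms -> load lg js (mid m) <= mcap m) /\ dstep jobs machs lg = lg \/
   measure (dstep jobs machs lg) < measure lg).
Proof.
move=> Hinv; have Hl' := @legal_step _ machs _ js_uniq (let: And4 h _ _ _ := Hinv in h).
move: Hl'; rewrite /dstep /dispair !difE.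
have := dactiveP lg jobs ms_pair; case: ifP => [_ [mm act]|_ H]; last by split=> //; left.
move: (dactive _ _ _) mm act => m mm act.
have [I1 I2 I3 I4] := Hinv.
have low := active_low Hinv mm act.
have vm : mid m \in vs by apply: map_f.
have := dmoveP lg jobs (dfst m); rewrite -/(mid m); case: ifP => _.
  case=> j0 [w [Hj0 -> Ej0 Hw Hlt]]; set lg' := Pair _ _ => Hl'.
  have hgtE : hgt lg' =1 hgt lg by [].
  have curE j : j \in js -> cur lg' j = if j == j0 then dnat w else cur lg j.
    move=> Hj; rewrite cur_move; case: (j =P j0) => [->|Nj]; first by rewrite eqxx.
    by case: eqP => // /(uniq_map_inj js_uniq Hj0 Hj) E; case: Nj.
  have wm : dnat w != mid m by apply: contraTneq Hlt => ->; rewrite ltnn.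
  have js_u : uniq js := map_uniq js_uniq.
  split; last first.
    right; rewrite /measure; rewrite ltn_add2r.
    apply: (ltn_sum_seq (i := j0)) => // [j Hj _|]; rewrite hgtE curE //; last first.
      by rewrite eqxx Ej0.
    by case: eqP => // ->; rewrite Ej0 ltnW.
  split=> //.
    move=> j u Hj Hu; rewrite !hgtE curE //; case: eqP => [Ej|_]; last exact: I2.
    by apply: leq_trans (ltnW Hlt) _; rewrite -Ej0; apply: I2 => //; rewrite -Ej.
  move=> v vv hv; case: (v =P mid m) => [Ev|Nv]; last first.
    apply: leq_trans (I3 v vv hv) _; apply: leq_sum_pred => j Hj /eqP Ej.
    by rewrite curE //; case: (j =P j0) => [Ejj|_]; [case: Nv; rewrite -Ej Ejj | apply/eqP].
  rewrite {v vv hv}Ev.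
  (* The machine that gives up [j0] was above its capacity, so by [L_job] it keeps load at least
     [L]. *)
  have : load lg js (mid m) <= jwt j0 + load lg' js (mid m).
    rewrite /load big_mkcond (bigD1_seq j0) //= Ej0 eqxx leq_add2l.
    rewrite -big_mkcondr; apply: leq_sum_pred => j Hj /andP[Nj Ej].
    by rewrite curE // (negbTE Nj).
  by have := L_job mm Hj0; move: act; rewrite -/js; lia.
move=> Hmin; set lg' := Pair _ _ => Hl'.
have hgtE u : hgt lg' u = (mid m == u) + hgt lg u by [].
have curE j : cur lg' j = cur lg j by [].
split; last first.
  right; rewrite /measure.
  have H1 : \sum_(j <- js) hgt lg' (cur lg' j) <= \sum_(j <- js) hgt lg (cur lg j) + size js.
    rewrite -sum1_size -big_split /=; apply: leq_sum => j _.
    by rewrite hgtE curE; case: eqP => _; lia.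
  suff H2 : \sum_(v <- vs) (size ms - hgt lg' v) < \sum_(v <- vs) (size ms - hgt lg v).
    by move: H1 H2; nia.
  apply: (ltn_sum_seq (i := mid m)) => // [v _ _|]; rewrite hgtE; last by rewrite eqxx; lia.
  by lia.
split=> //.
- move=> j u Hj Hu; rewrite !hgtE curE; case: eqP => [Ej|_] /=; last first.
    by apply: leq_trans (I2 j u Hj Hu) _; lia.
  (* Relabelling happens only when no allowed machine is lower, so after raising by one the drop is
     still at most one. *)
  by have := Hmin j u Hj (esym Ej) Hu; rewrite Ej; lia.
- move=> v vv; rewrite hgtE; case: eqP => [<- _|_]; last exact: I3.
  by apply: leq_trans (L_cap mm) (ltnW act).
- by move=> v vv; rewrite hgtE; case: eqP => [<-|_] //; exact: I4.
Qed.

Theorem push_relabel m : m \in ms -> load (drun jobs machs) js (mid m) <= mcap m.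
Proof.
rewrite drun_iter -/js -/ms; set lg0 := Pair _ _.
have inv0 : pr_inv lg0 by split=> //; exact: legal0.
(* This is exactly the number of iterations of [drun], and each step lowers the potential until no
   machine is overloaded. *)
have M0 : measure lg0 = (size js).+1 * size ms ^ 2.
  rewrite /measure big1 // (eq_bigr (fun=> size ms)) => [|v _]; last by rewrite subn0.
  by rewrite big_const_seq count_predT iter_addn_0 size_map mulnn.
suff H k lg : pr_inv lg -> measure lg <= k -> forall m, m \in ms ->
    load (iter k (dstep jobs machs) lg) js (mid m) <= mcap m.
  by rewrite -M0; apply: H.
elim: k lg => [|k IH] lg Hinv Hk {}m mm.
  by have [_ [[H _]|]] := pr_step Hinv; [exact: H | move: Hk; rewrite leqn0 => /eqP->].
rewrite iterSr; have [Hinv' [[H E]|Hlt]] := pr_step Hinv.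
  by rewrite E iter_fix //; exact: H.
by apply: IH => //; rewrite -ltnS; apply: leq_trans Hk.
Qed.

End PushRelabel.

(** * Orienting the big edges *)

Section Roots.

Variables (V E : finType) (ends : E -> V * V) (P : pred E) (x : V -> nat) (g : nat).

Definition inner (R : {set V}) : {set E} :=
  [set e | [&& P e, (ends e).1 \in R & (ends e).2 \in R]].

(** This condition characterises pseudoforests: every component has at most one cycle. *)
Hypothesis inner_le : forall R, #|inner R| <= #|R|.
(** Each inner edge uses [g] units of a budget of [g] per vertex, and [x v] further units are spent
    at [v]; all is doubled to match the threshold [2 * x v <= g]. *)
Hypothesis inner_x : forall R, 2 * g * #|inner R| + \sum_(v in R) 2 * x v <= 2 * g * #|R|.

Lemma inner_sub (S R : {set V}) : S \subset R -> inner S \subset inner R.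
Proof.
move=> /subsetP SR; apply/subsetP => e; rewrite !inE.
by case/and3P=> -> /SR-> /SR->.
Qed.

(* A connected set has at least [#|R| - 1] inner edges, hence at most one vertex
   with [g < 2 * x v]; a disconnected one splits. *)
Lemma inner_roots (R : {set V}) : #|inner R| <= #|[set v in R | 2 * x v <= g]|.
Proof.
have [n] := ubnP #|R|; elim: n R => // n IH R; rewrite ltnS => Rn.
have [->|/set0Pn[v vR]] := eqVneq R set0.
  by apply: leq_trans (inner_le _) _; rewrite cards0.
(* [S] splits [R] when no inner edge of [R] runs between [S] and [R :\: S]. *)
pose split (S : {set V}) := [&& S != set0, S \proper R & inner R \subset inner S :|: inner (R :\: S)].
case: (pickP split) => [S /and3P[S0 SR Sin]|nosplit].
  have SsR := proper_sub SR.
  have cS : #|S| + #|R :\: S| = #|R| by rewrite -(cardsID S R) (setIidPr SsR).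
  have S_gt0 : 0 < #|S| by rewrite card_gt0.
  have D_gt0 : 0 < #|R :\: S| by have := proper_card SR; lia.
  apply: leq_trans (subset_leq_card Sin) _; apply: leq_trans (leq_card_setU _ _) _.
  apply: leq_trans (leq_add (IH S _) (IH (R :\: S) _)) _; try lia.
  rewrite -cardsUI; set I := _ :&: _.
  have -> : I = set0 by apply/setP => u; rewrite !inE; case: (u \in S); rewrite ?andbF.
  rewrite cards0 addn0; apply: subset_leq_card; apply/subsetP => u; rewrite !inE.
  by case/orP=> /andP[]; [move/(subsetP SsR)-> | case/andP=> _ ->].
have Rconn : #|R| <= #|inner R|.+1.
  (* A maximal such set must be all of [R]: since nothing splits [R], an edge leaves any proper one,
     and adding its outer end gains one vertex and at least one inner edge. *)
  pose big (S : {set V}) := [&& v \in S, S \subset R & #|S| <= #|inner S|.+1].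
  have big1 : big [set v] by rewrite /big set11 sub1set vR cards1.
  have [S /maxsetP[/and3P[vS SsR cS] Smax] _] := maxset_exists big1.
  have [->|SnR] := eqVneq R S; first by [].
  have SR : S \proper R by rewrite properEneq eq_sym SnR.
  have := nosplit S; rewrite /split SR; have -> /= : S != set0 by apply/set0Pn; exists v.
  move=> /negbT/subsetPn[e]; rewrite !inE.
  case/and3P=> Pe e1 e2; rewrite Pe e1 e2 /= !andbT => Hcross.
  have [y [yR yS eS]] : exists y, [/\ y \in R, y \notin S & e \in inner (y |: S)].
    case E1 : ((ends e).1 \in S) Hcross; case E2 : ((ends e).2 \in S) => //= _.
    - by exists (ends e).2; rewrite !inE Pe E1 E2 eqxx orbT.
    - by exists (ends e).1; rewrite !inE Pe E1 E2 eqxx orbT.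
  have eNS : e \notin inner S by rewrite inE Pe; apply: contra Hcross => /= ->.
  have bigS : big (y |: S).
    rewrite /big in_setU vS orbT subUset sub1set yR SsR cardsU1 yS add1n /= ltnS.
    apply: leq_trans cS _; apply: proper_card; rewrite properE inner_sub ?subsetUr //.
    by apply/subsetPn; exists e.
  by have ES := Smax _ bigS (subsetUr _ _); rewrite -ES setU11 in yS.
have Hx := inner_x R; have Hle := inner_le R.
have cR : #|R| = #|[set v in R | 2 * x v <= g]| + #|[set v in R | g < 2 * x v]|.
  rewrite -(cardsID [set v | 2 * x v <= g] R); congr (_ + _); apply: eq_card => u.
    by rewrite !inE.
  by rewrite !inE ltnNge andbC.
have Hsum : #|[set v in R | g < 2 * x v]| * g.+1 <= \sum_(v in R) 2 * x v.
  rewrite -sum_nat_const big_mkcond [X in _ <= X]big_mkcond; apply: leq_sum => u _.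
  by rewrite inE; case: (u \in R) => //=; case: ltnP.
(* By [Rconn] and [Hle], [f] is [r] or [r - 1]. In the first case [Hx] forces [t = 0], so [b = 0];
   in the second [b * g.+1 <= 2 * g], so [b <= 1]. *)
move: (#|inner R|) (#|R|) cR Hsum Hx Hle Rconn => f r ->.
move: #|_| #|_| (\sum_(_ in _) _) => a b t; nia.
Qed.

End Roots.

(** * Encodings *)

Lemma dlistK s : dlist (enc_seq s) = s.
Proof. by elim: s => //= x s ->. Qed.

Lemma dfold_map F l : dlist (dfold (fun e a => Pair (F e) a) (Atom 0) l) = map F (dlist l).
Proof. by rewrite dfoldE; elim: (dlist l) => //= x s ->. Qed.

Lemma dfold_max (F : data -> data) (f : data -> nat) l :
  (forall x, x \in dlist l -> F x = Atom (f x)) ->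
  dfold (fun v a => dif (a <=d F v) (F v) a) (Atom 0) l = Atom (\max_(x <- dlist l) f x).
Proof.
rewrite dfoldE; elim: (dlist l) => [|x s IH] H /=; first by rewrite big_nil.
rewrite big_cons IH => [|y ys]; last by apply: H; rewrite in_cons ys orbT.
by rewrite H ?mem_head // /dop difE /=; case: leqP => _; congr Atom; lia.
Qed.

Lemma sum_enum (T : finType) (P : pred T) (F : T -> nat) :
  \sum_(i <- enum T | P i) F i = \sum_(i | P i) F i.
Proof. by rewrite big_enum_cond; apply: eq_bigl. Qed.

Section Encoding.

Variable G : instance.
Let es := enum (edge G).

Definition rk (v : vertex G) : nat := enum_rank v.
Definition den (e : edge G) : nat := `|denq (weight e)|%N.
Definition num (e : edge G) : nat := `|numq (weight e)|%N.
Definition Den : nat := \prod_(e <- es) den e.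
Definition W (e : edge G) : nat := num e * (Den %/ den e).
Definition idx (e : edge G) : nat := size es - (index e es).+1.
Definition er (e : edge G) : data :=
  Pair (Atom (idx e)) (Pair (Pair (Atom (rk (ends e).1)) (Atom (rk (ends e).2))) (Atom (W e))).
Definition dV : data := enc_seq [seq enc_vertex v | v <- enum (vertex G)].
Definition dE : data := dedges (enc_seq [seq enc_edge e | e <- es]).

Lemma rk_inj : injective rk.
Proof. by move=> u v /ord_inj /enum_rank_inj. Qed.

Lemma idx_inj : injective idx.
Proof.
move=> a b; rewrite /idx => E.
have Ha : index a es < size es by rewrite index_mem mem_enum.
have Hb : index b es < size es by rewrite index_mem mem_enum.
have : index a es = index b es by lia.
by move/(congr1 (nth a es)); rewrite !nth_index ?mem_enum.
Qed.

Lemma idx_lt e : idx e < size es.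
Proof. by have : index e es < size es; [rewrite index_mem mem_enum | rewrite /idx; lia]. Qed.

Lemma dlist_dV : dlist dV = [seq Atom (rk v) | v <- enum (vertex G)].
Proof. exact: dlistK. Qed.

Lemma dlist_dE : dlist dE = [seq er e | e <- es].
Proof.
rewrite /dE /dedges; set den0 := dden _.
have -> : den0 = Atom Den.
  rewrite /den0 /dden dfoldE dlistK /Den; elim: es => [|e s IH] /=; first by rewrite big_nil.
  by rewrite big_cons IH /dop /= mulnC.
rewrite /er /idx; have : uniq es := enum_uniq _.
elim: es => //= e s IH /andP[es' us].
rewrite eqxx {}IH // dlenE dlistK size_map /dop /= subn1 /=; congr cons.
apply/eq_in_map => e' He'; have -> : (e == e') = false; last by rewrite subSS.
by apply/eqP => E; rewrite E He' in es'.
Qed.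

Lemma den_gt0 e : 0 < den e.
Proof. by rewrite /den absz_gt0 denq_neq0. Qed.

Lemma Den_gt0 : 0 < Den.
Proof. by rewrite /Den prodn_gt0 // => e; apply: den_gt0. Qed.

(** The division in [W] is exact because [den e] divides [Den]. *)
Lemma W_weight e : ((W e)%:R = weight e * Den%:R :> rat)%R.
Proof.
have dv : den e %| Den.
  rewrite /Den big_enum /= (bigD1 e) //=; exact: dvdn_mulr.
rewrite /W; case/dvdnP: dv => q ->; rewrite mulnK ?den_gt0 // !natrM.
have Hd : ((denq (weight e))%:~R : rat) != 0%R by rewrite intr_eq0 denq_neq0.
have Hn : (0 <= numq (weight e))%R by rewrite numq_ge0 ltW // weight_gt0.
have -> : ((num e)%:R = weight e * (den e)%:R :> rat)%R.
  rewrite /num /den !natr_absz (ger0_norm Hn) (gtr0_norm (denq_gt0 _)).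
  by rewrite -{2}[weight e]divq_num_den divfK.
by rewrite -mulrA [((den e)%:R * _)%R]mulrC.
Qed.

Lemma W_gt0 e : 0 < W e.
Proof.
have : (0 < (W e)%:R :> rat)%R by rewrite W_weight mulr_gt0 ?weight_gt0 // ltr0n Den_gt0.
by rewrite ltr0n.
Qed.

Definition nload (o : assignment G) (v : vertex G) : nat := \sum_(e | o e == v) W e.
Definition mk (o : assignment G) : nat := \max_v nload o v.

(** Scaling by the positive [Den] commutes with sums and maxima, so approximation ratios can be
    checked on integer loads. *)
Lemma makespanE o : (makespan o = (mk o)%:R / Den%:R)%R.
Proof.
have D0 : (Den%:R != 0 :> rat)%R by rewrite pnatr_eq0 -lt0n Den_gt0.
rewrite /makespan /mk.
rewrite (big_morph (fun n : nat => (n%:R / Den%:R)%R : rat) (id1 := 0%R) (op1 := Order.max)).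
- apply: eq_bigr => v _; apply: (canRL (mulfK D0)).
  by rewrite /indegree /nload natr_sum mulr_suml; apply: eq_bigr => e _; rewrite W_weight.
- move=> a b; case: (leqP a b) => H.
    rewrite max_r // ler_pM2r ?ler_nat // invr_gt0 ltr0n Den_gt0 //.
  by rewrite max_l // ler_pM2r ?ler_nat ?(ltnW H) // invr_gt0 ltr0n Den_gt0.
- by rewrite mul0r.
Qed.

Definition represents (c : data) (o : assignment G) : Prop :=
  is_orientation o /\ dlist c = [seq Pair (Atom (rk (o e))) (Atom (W e)) | e <- es].

Lemma cmakespanE c o : represents c o -> cmakespan dV c = Atom (mk o).
Proof.
case=> _ cE; rewrite /cmakespan.
rewrite (dfold_max (f := fun v => \sum_(e | rk (o e) == dnat v) W e)) => [|v _].
  congr Atom; rewrite dlist_dV big_map big_enum /mk; apply: eq_bigr => v _.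
  by apply: eq_bigl => e; rewrite /= (inj_eq rk_inj).
rewrite /cload dfoldE cE -sum_enum -/es; elim: es => [|e s IH] /=.
  by rewrite big_nil.
by rewrite big_cons {}IH deqE difE /=; case: ifP => _ //; rewrite /dop /= addnC.
Qed.

Lemma cand0P : represents (cand0 dE) (default_orientation G).
Proof.
split; first exact: default_orientationP.
rewrite /cand0 dfold_map dlist_dE -map_comp; apply: eq_map => e /=.
by rewrite /default_orientation ffunE.
Qed.

Lemma bestP : (forall c, c \in dlist (cands dV dE) -> exists o, represents c o) ->
  exists2 o, represents (best dV dE) o &
    forall c o', c \in dlist (cands dV dE) -> represents c o' -> mk o <= mk o'.
Proof.
rewrite /best dfoldE; elim: (dlist (cands _ _)) => [|c s IH] H /=.
  by exists (default_orientation G) => //; exact: cand0P.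
have [|o Ho Hmin] := IH _; first by move=> c' Hc'; apply: H; rewrite in_cons Hc' orbT.
have [oc Hoc] := H c (mem_head _ _).
(* The makespan can be read off [c] by [cmakespan], so all orientations represented by [c] agree on
   it. *)
have Huniq o' : represents c o' -> mk o' = mk oc.
  by move=> H'; have := cmakespanE H'; rewrite (cmakespanE Hoc) => -[].
rewrite /better (cmakespanE Ho) (cmakespanE Hoc) /dop difE /=; case: leqP => Hle.
  exists oc => // c' o'; rewrite in_cons => /orP[/eqP->|Hc'] Ho'; first by rewrite (Huniq o').
  exact: leq_trans Hle (Hmin _ _ Hc' Ho').
exists o => // c' o'; rewrite in_cons => /orP[/eqP->|Hc'] Ho'; last exact: Hmin Hc' Ho'.
by rewrite (Huniq o') // ltnW.
Qed.

Lemma balanceE o : represents (best dV dE) o ->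
  balance (enc_instance G) = enc_orientation o.
Proof.
case=> _ cE; rewrite /balance /= -/dV -/dE dfoldE cE /enc_orientation.
by rewrite /es; elim: (enum _) => //= e s ->.
Qed.

End Encoding.

(** * Runs whose jobs are whole edges, and the first candidate *)

Section EdgeRuns.

Variable G : instance.
Let es := enum (edge G).
Local Notation vx := (vertex G).
Implicit Types (e : edge G) (v : vx).
Local Notation wmax := (\max_(e : edge G) W e).

Lemma jal_ejob e x : jal (ejob (er e) x) = [:: rk (ends e).1; rk (ends e).2].
Proof. by []. Qed.

Lemma rk_eq u v : (rk u == rk v) = (u == v).
Proof. exact: (inj_eq (@rk_inj G)). Qed.

Lemma orientation_of (hd : edge G -> nat) :
  (forall e, hd e \in [:: rk (ends e).1; rk (ends e).2]) ->
  exists o : assignment G, is_orientation o /\ forall e, rk (o e) = hd e.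
Proof.
move=> H.
exists [ffun e => if hd e == rk (ends e).1 then (ends e).1 else (ends e).2]; split.
  by apply/forallP => e; rewrite ffunE; case: ifP; rewrite eqxx ?orbT.
move=> e; rewrite ffunE; case: eqP => [->//|N]; have := H e.
by rewrite !inE => /orP[] /eqP.
Qed.

Section Run.

Variables (P : pred (edge G)) (w : edge G -> nat) (jobs machs : data).
Hypothesis jobsE : dlist jobs = [seq ejob (er e) (Atom (w e)) | e <- es & P e].
Let head e := cur (drun jobs machs) (ejob (er e) (Atom (w e))).

Lemma edge_job j : j \in dlist jobs -> exists2 e, P e & j = ejob (er e) (Atom (w e)).
Proof. by rewrite jobsE => /mapP[e]; rewrite mem_filter => /andP[Pe _] ->; exists e. Qed.

Lemma edge_jobs_uniq : uniq (map jid (dlist jobs)).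
Proof.
rewrite jobsE -map_comp map_inj_uniq; last by move=> a b /= /idx_inj.
by apply: filter_uniq; exact: enum_uniq.
Qed.

Lemma edge_run_legal e : P e -> head e \in [:: rk (ends e).1; rk (ends e).2].
Proof.
move=> Pe; rewrite -(jal_ejob e (Atom (w e))); apply: legal_drun.
- exact: edge_jobs_uniq.
- by move=> j /edge_job[e' _ ->].
- by rewrite jobsE; apply: map_f; rewrite mem_filter Pe mem_enum.
Qed.

Lemma edge_run (cap L : vx -> nat) :
  dlist machs = [seq Pair (Atom (rk v)) (Atom (cap v)) | v <- enum vx] ->
  (forall v, L v <= cap v) ->
  (forall v e, P e -> L v + w e <= (cap v).+1) ->
  (forall R : {set vx}, \sum_(e | [&& P e, (ends e).1 \in R & (ends e).2 \in R]) w e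
     <= \sum_(v in R) L v) ->
  forall v, \sum_(e | P e && (head e == rk v)) w e <= cap v.
Proof.
move=> machsE LC LJ Hall v.
(* [L] is transported to machine identifiers: the sum has one term at [rk u] and is empty off the
   ranks. *)
pose Ln n := \sum_(u | rk u == n) L u.
have LnE u : Ln (rk u) = L u.
  by rewrite /Ln (big_pred1 u) // => u'; rewrite rk_eq.
have midE : map mid (dlist machs) = map (@rk G) (enum vx) by rewrite machsE -map_comp.
pose m := Pair (Atom (rk v)) (Atom (cap v)).
suff : load (drun jobs machs) (dlist jobs) (mid m) <= mcap m.
  by rewrite /load jobsE big_map big_filter_cond sum_enum.
apply: (push_relabel (L := Ln)).
- exact: edge_jobs_uniq.
- by rewrite midE map_inj_uniq ?enum_uniq //; exact: rk_inj.
- by rewrite machsE all_map; apply/allP.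
- by move=> j /edge_job[e _ ->].
- move=> j /edge_job[e _ ->] n; rewrite jal_ejob midE !inE.
  by case/orP=> /eqP->; apply: map_f; rewrite mem_enum.
- by move=> m'; rewrite machsE => /mapP[u _ ->]; rewrite LnE; exact: LC.
- move=> m' j; rewrite machsE => /mapP[u _ ->] /edge_job[e Pe ->].
  by rewrite LnE; exact: LJ.
- move=> R; rewrite midE jobsE !big_map big_filter_cond !sum_enum.
  have := Hall [set u | R (rk u)]; congr (_ <= _).
    by apply: eq_bigl => e; rewrite !inE jal_ejob /= andbT.
  by apply: eq_big => [u|u _]; rewrite ?inE // LnE.
- by rewrite machsE map_f // mem_enum.
Qed.

End Run.

(** An edge with both ends in [R] has its head in [R]; in this way an orientation certifies Hall
    conditions. *)
Lemma sum_ends (o : assignment G) (P : pred (edge G)) (w : edge G -> nat) (R : {set vx}) :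
  is_orientation o ->
  \sum_(e | [&& P e, (ends e).1 \in R & (ends e).2 \in R]) w e
    <= \sum_(v in R) \sum_(e | P e && (o e == v)) w e.
Proof.
move=> /forallP Ho.
rewrite [X in _ <= X](_ : _ = \sum_(e | P e && (o e \in R)) w e).
  rewrite big_mkcond [X in _ <= X]big_mkcond; apply: leq_sum => e _.
  case: ifP => // /and3P[-> e1 e2] /=.
  by case/orP: (Ho e) => /eqP->; rewrite ?e1 ?e2.
rewrite (partition_big (fun e => o e) (mem R)) /=; last by move=> e /andP[].
apply: eq_bigr => v vR; apply: eq_bigl => e.
by case: eqP => [->|]; rewrite ?andbF // vR !andbT.
Qed.

Lemma candA_represents U :
  exists o : assignment G, represents (candA (dV G) (dE G) U) o /\
    forall e, rk (o e) = cur (drun (ejobs (dE G)) (emachs (dV G) U)) (ejob (er e) (Atom (W e))).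
Proof.
have jobsE : dlist (ejobs (dE G)) = [seq ejob (er e) (Atom (W e)) | e <- es & predT e].
  by rewrite /ejobs dfold_map dlist_dE -map_comp filter_predT.
have [o [Ho oE]] := orientation_of (fun e => edge_run_legal (emachs (dV G) U) jobsE (e := e) isT).
exists o; split=> //; split=> //.
rewrite /candA dfold_map dlist_dE -map_comp; apply: eq_map => e /=.
by rewrite oE /dop /= addn0.
Qed.

Lemma nload_run (o : assignment G) (f : edge G -> nat) v :
  (forall e, rk (o e) = f e) -> nload o v = \sum_(e | f e == rk v) W e.
Proof. by move=> oE; apply: eq_bigl => e; rewrite -oE rk_eq. Qed.

Lemma nload_mk (o : assignment G) v : nload o v <= mk o.
Proof. exact: leq_bigmax. Qed.

(** Push-relabel with threshold [mk ostar] and capacity larger by [b]: the slack covers any one job,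
    and [ostar] certifies the Hall condition. *)
Lemma candA_load (ostar : assignment G) (b : nat) :
  is_orientation ostar -> (forall e, W e <= b) ->
  exists2 o : assignment G, represents (candA (dV G) (dE G) (Atom (mk ostar + b))) o &
    mk o <= mk ostar + b.
Proof.
move=> Hs Hb; have [o [Ho oE]] := candA_represents (Atom (mk ostar + b)).
exists o => //; apply/bigmax_leqP => v _; rewrite (nload_run _ oE).
have jobsE : dlist (ejobs (dE G)) = [seq ejob (er e) (Atom (W e)) | e <- es & predT e].
  by rewrite /ejobs dfold_map dlist_dE -map_comp filter_predT.
apply: (edge_run jobsE (cap := fun=> mk ostar + b) (L := fun=> mk ostar)).
- by rewrite /emachs dfold_map dlist_dV -map_comp.
- by move=> _; rewrite leq_addr.
- by move=> _ e _; rewrite leqW // leq_add2l.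
- move=> R; apply: leq_trans (sum_ends predT _ R Hs) _.
  by apply: leq_sum => u _; apply: nload_mk.
Qed.

Lemma dmaxwE : dmaxw (dE G) = Atom (wmax).
Proof.
rewrite /dmaxw (dfold_max (f := fun x => dnat (ewt x))) => [|x].
  by rewrite dlist_dE big_map big_enum.
by rewrite dlist_dE => /mapP[e _ ->].
Qed.

(** The scan keeps its starting value [wmax] when no edge is lighter, in particular when there is no
    edge. *)
Lemma dminwP : exists s, [/\ dminw (dE G) = Atom s, forall e : edge G, s <= W e
  & s = wmax \/ exists e : edge G, s = W e].
Proof.
rewrite /dminw dmaxwE dfoldE dlist_dE.
suff [s [-> H1 H2]] : exists s, [/\ foldr (fun x a => dif (a <=d ewt x) a (ewt x))
    (Atom (wmax)) [seq er e | e <- es] = Atom s, forall e, e \in es -> s <= W e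
    & s = wmax \/ exists e : edge G, s = W e].
  by exists s; split=> // e; apply: H1; rewrite mem_enum.
elim: es => [|e t [s [/= -> H1 H2]]] /=; first by eexists; split; [reflexivity| |left].
rewrite /dop difE /=; case: (leqP s (W e)) => Hle; eexists; (split; first reflexivity) => //.
- by move=> e'; rewrite in_cons => /orP[/eqP->//|]; apply: H1.
- move=> e'; rewrite in_cons => /orP[/eqP->//|/H1]; apply: leq_trans; exact: ltnW.
- by right; exists e.
Qed.

(** Otherwise [e], a heaviest and a lightest edge would have three distinct weights, since scaled
    weights differ only if the original ones do. *)
Lemma two_weights s : at_most_two_weights G -> (forall e : edge G, s <= W e) ->
  s = wmax \/ (exists e : edge G, s = W e) ->
  forall e : edge G, W e = s \/ W e = wmax.
Proof.
move=> two smin sE e; set b := \max_(e : edge G) _ in sE *.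
case: (W e =P s) => [|Ns]; first by left.
case: (W e =P b) => [|Nb]; first by right.
have Wb : W e <= b by apply: leq_bigmax.
have [e1 E1] : exists e1, b = W e1.
  by have [|e1 _ E1] := @eq_bigmax_cond _ predT (fun e => W e); [apply/card_gt0P; exists e | exists e1].
have [e2 E2] : exists e2, s = W e2 by case: sE => // Esb; case: Ns; have := smin e; lia.
have W_inj (f g : edge G) : weight f = weight g -> W f = W g.
  by rewrite /W /num /den => ->.
have U : uniq [:: weight e; weight e1; weight e2].
  rewrite /= !inE !andbT negb_or -andbA; apply/and3P; split; apply/eqP => /W_inj; rewrite -?E1 -?E2 //.
  by have := smin e; lia.
have /(uniq_leq_size U) : {subset [:: weight e; weight e1; weight e2] <=
    undup [seq weight e | e <- enum (edge G)]}.
  by move=> x; rewrite mem_undup !inE => /or3P[] /eqP->; apply: map_f; rewrite mem_enum.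
by move/leq_trans/(_ two).
Qed.

End EdgeRuns.

Lemma drangeE l : dlist (drange l) = [seq Atom i | i <- rev (iota 0 (size (dlist l)).+1)].
Proof.
suff H k : dlist (drec (fun l a => Pair (dlen (dsnd l)) a) (Atom 0) k) =
    [seq Atom i | i <- rev (iota 0 (size (dlist k)))] by rewrite /drange H.
elim: k => // x _ k IH.
have -> : size (dlist (Pair x k)) = size (dlist k) + 1 by rewrite addn1.
by rewrite iotaD rev_cat /= IH dlenE.
Qed.

(** * The fractional relaxation and the second candidate *)

Section Fractional.

Variables (G : instance) (b g h : nat).
Let es := enum (edge G).
Local Notation vx := (vertex G).
Let big (e : edge G) : bool := b <= W e.

(** Jobs are indexed uniformly by an edge and a number: a token number for a big edge, a dummy 0 for
    a small one. The numbers stop at [|E|], so a big edge has all its [g] tokens only if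
    [g <= |E| + 1]. *)
Let ts (e : edge G) : seq nat :=
  if big e then [seq t <- rev (iota 0 (size es).+1) | t < g] else [:: 0].
Let fj (e : edge G) (t : nat) : data :=
  if big e then tokenjob (dlen (dE G)) (er e) (Atom t) else smalljob (er e).
Let mj (v : vx) (i : bool) : data :=
  if i then Pair (mach1 (Atom (rk v))) (Atom h) else Pair (mach0 (Atom (rk v))) (Atom g).
Let gh := Pair (Atom g) (Atom h).
Let jobs := fjobs (dE G) (Atom b) (Atom g).
Let machs := fmachs (dV G) (Atom g) (Atom h).
Let lg := frun (dV G) (dE G) (Atom b) gh.
Let at_small (e : edge G) : nat := cur lg (smalljob (er e)).

Lemma fjobsE : dlist jobs = [seq fj e t | e <- es, t <- ts e].
Proof.
rewrite /jobs /fjobs; set D := dE G.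
have H F a R : dlist (dfold (fun t a' => dif (t +d Atom 1 <=d Atom g) (Pair (F t) a') a')
    a R) = [seq F t | t <- dlist R & dnat t < g] ++ dlist a.
  rewrite dfoldE; elim: (dlist R) => //= t s IH; rewrite /dop difE /= addn1.
  by case: ifP; rewrite /= IH.
rewrite dfoldE {2}/D dlist_dE -/es /fj /ts; elim: {1 3}es => //= e s IH.
rewrite /dop difE /= -/(big e); case: ifP => _; last by rewrite /= IH.
rewrite H IH drangeE /D dlist_dE size_map -/es filter_map -map_comp; congr (_ ++ _).
Qed.

Lemma fmachsE : dlist machs = [seq mj v i | v <- enum vx, i <- [:: false; true]].
Proof.
by rewrite /machs /fmachs dfoldE dlist_dV; elim: (enum _) => //= v s ->.
Qed.

Lemma jid_fj e t : t \in ts e -> jid (fj e t) = t * size es + idx e.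
Proof.
rewrite /ts /fj; case: ifP => _; first by rewrite dlenE dlist_dE size_map.
by rewrite inE => /eqP->.
Qed.

Lemma jwt_fj e t : jwt (fj e t) = 1.
Proof. by rewrite /fj; case: ifP. Qed.

Lemma jal_fj e t : jal (fj e t) =
  if big e then [:: 2 * rk (ends e).1; 2 * rk (ends e).2]
  else [:: 2 * rk (ends e).1; 2 * rk (ends e).1 + 1; 2 * rk (ends e).2; 2 * rk (ends e).2 + 1].
Proof. by rewrite /fj; case: ifP. Qed.

Lemma mid_mj v i : mid (mj v i) = 2 * rk v + i.
Proof. by case: i; rewrite /mid /= ?addn0. Qed.

Lemma mcap_mj v i : mcap (mj v i) = if i then h else g.
Proof. by case: i. Qed.

Lemma uniq_ts e : uniq (ts e).
Proof. by rewrite /ts; case: ifP => // _; rewrite filter_uniq // rev_uniq iota_uniq. Qed.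

Lemma fjobs_uniq : uniq (map jid (dlist jobs)).
Proof.
rewrite fjobsE map_allpairs.
have -> : [seq jid (fj e t) | e <- es, t <- ts e] =
    [seq t * size es + idx e | e <- es, t <- ts e].
  by apply/eq_in_allpairs_dep => e _ t /jid_fj.
apply: allpairs_uniq_dep => [|e _|]; [exact: enum_uniq | exact: uniq_ts |].
move=> [e t] [e' t'] _ _ /= E.
have He : idx e < size es := idx_lt e; have He' : idx e' < size es := idx_lt e'.
(* Edge indices are below [size es], so [t] is the quotient of the identifier by [size es]. *)
have Et : t = t'.
  by have := congr1 (fun n => n %/ size es) E; rewrite !divnMDl ?divn_small ?addn0 //; lia.
by move: E; rewrite Et => /addnI /idx_inj ->.
Qed.

Lemma fj_cases j : j \in dlist jobs -> exists e t, [/\ t \in ts e & j = fj e t].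
Proof. by rewrite fjobsE => /allpairsPdep[e [t [_ Ht ->]]]; exists e, t. Qed.

Lemma fj_mem e t : t \in ts e -> fj e t \in dlist jobs.
Proof. by move=> Ht; rewrite fjobsE; apply/allpairsPdep; exists e, t; rewrite mem_enum. Qed.

Lemma cur_fj e t : t \in ts e -> cur lg (fj e t) \in jal (fj e t).
Proof.
move=> Ht; apply: legal_drun (fj_mem Ht); first exact: fjobs_uniq.
by move=> j /fj_cases[e' [t' [_ ->]]]; rewrite jal_fj; case: ifP.
Qed.

Lemma fj_small e : ~~ big e -> fj e 0 = smalljob (er e).
Proof. by rewrite /fj => /negbTE->. Qed.

Lemma at_small_half e : ~~ big e ->
  at_small e %/ 2 \in [:: rk (ends e).1; rk (ends e).2].
Proof.
move=> sm; have := @cur_fj e 0; rewrite /ts jal_fj fj_small // (negbTE sm) => /(_ isT).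
by rewrite -/(at_small e) !inE => /or4P[] /eqP->; rewrite mulnC ?divnMDl // ?mulnK // ?addn0 eqxx ?orbT.
Qed.

Let tokens (p : pred nat) (e : edge G) : nat := \sum_(t <- ts e | p (cur lg (fj e t))) 1.

Lemma fload n : load lg (dlist jobs) n = \sum_e tokens (pred1 n) e.
Proof.
rewrite /load big_mkcond fjobsE big_allpairs_dep big_enum; apply: eq_bigr => e _.
by rewrite -big_mkcond; apply: eq_bigr => t _; rewrite jwt_fj.
Qed.

Lemma size_ts_le e : big e -> size (ts e) <= g.
Proof.
rewrite -[X in _ <= X](size_iota 0 g) => be; apply: uniq_leq_size; first exact: uniq_ts.
by move=> t; rewrite /ts be mem_filter mem_iota => /andP[].
Qed.

Lemma size_ts e : big e -> g <= (size es).+1 -> size (ts e) = g.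
Proof.
move=> be gm; rewrite -[RHS](size_iota 0 g); apply/perm_size/uniq_perm.
- exact: uniq_ts.
- exact: iota_uniq.
move=> t; rewrite /ts be mem_filter mem_rev !mem_iota /= !add0n.
by case: ltnP => //= tg; rewrite (leq_trans tg gm).
Qed.

(** At [v], [X] counts the extra small edges, [Z] those in the allotment [h], and [Y] the tokens. *)
Let X (v : vx) := \sum_(e | ~~ big e && (at_small e == 2 * rk v)) 1.
Let Z (v : vx) := \sum_(e | ~~ big e && (at_small e == 2 * rk v + 1)) 1.
Let Y (v : vx) := \sum_(e | big e) tokens (pred1 (2 * rk v)) e.

Let lgb := bigrun (dV G) (dE G) (Atom b) gh.
Let bhead (e : edge G) := cur lgb (ejob (er e) (Atom 1)).

Lemma bigjobsE :
  dlist (bigjobs (dE G) (Atom b)) = [seq ejob (er e) (Atom 1) | e <- es & big e].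
Proof.
rewrite /bigjobs dfoldE dlist_dE -/es; elim: es => //= e s IH.
by rewrite /dop difE /= -/(big e); case: ifP => _ //=; rewrite IH.
Qed.

Lemma extraE v : extra lg (dE G) (Atom b) (Atom (rk v)) = Atom (X v).
Proof.
rewrite /X -sum_enum /extra dfoldE dlist_dE -/es; elim: es => [|e s IH] /=.
  by rewrite big_nil.
rewrite big_cons /dop difE /= -/(big e) IH; case: (big e) => //=.
rewrite deqE difE -/(at_small e); case: eqP => //= _.
by rewrite /dop /= addnC.
Qed.

Lemma bigmachsE : dlist (bigmachs (dV G) (dE G) (Atom b) gh) =
  [seq Pair (Atom (rk v)) (Atom (2 * X v <= g : bool)) | v <- enum vx].
Proof.
rewrite /bigmachs dfold_map dlist_dV -map_comp; apply: eq_map => v /=.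
by rewrite -/lg extraE /dop difE /=; case: (_ <= _).
Qed.

Lemma candB_represents :
  exists o : assignment G, represents (candB (dV G) (dE G) (Atom b) gh) o /\
    forall e, rk (o e) = if big e then bhead e else at_small e %/ 2.
Proof.
have [e|o [Ho oE]] :=
  @orientation_of G (fun e => if big e then bhead e else at_small e %/ 2).
  case: ifP => be; last by apply: at_small_half; rewrite be.
  exact: (edge_run_legal (bigmachs (dV G) (dE G) (Atom b) gh) bigjobsE be).
exists o; split=> //; split=> //.
rewrite /candB dfold_map dlist_dE -map_comp; apply: eq_map => e /=.
by rewrite oE /dop difE /= -/(big e); case: ifP => _ //=; rewrite addn0.
Qed.

Section Feasible.

Variable ostar : assignment G.
Hypothesis ostarP : is_orientation ostar.
Let K (v : vx) := #|[set e | (ostar e == v) && big e]|.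
Let N (v : vx) := #|[set e | (ostar e == v) && ~~ big e]|.
Hypothesis K_le1 : forall v, K v <= 1.
Hypothesis NK_le : forall v, N v + g * K v <= g + h.

(** Each confined job is charged to the head of its edge under [ostar]. At a vertex with both
    machines in [R], [NK_le] bounds the charge; with only the even one, just tokens can be confined
    and [K_le1] suffices. *)
Lemma fhall (R : pred nat) :
  \sum_(j <- dlist jobs | all R (jal j)) jwt j <=
  \sum_(v : vx) (R (2 * rk v) * g + R (2 * rk v + 1) * h).
Proof.
rewrite big_mkcond fjobsE big_allpairs_dep big_enum.
(* [c v be] tells whether [R] contains all machines of [v] open to a big edge (if [be]) or to a
   small one. *)
pose c (v : vx) (be : bool) : bool := R (2 * rk v) && (be || R (2 * rk v + 1)).
apply: (@leq_trans (\sum_e c (ostar e) (big e) * (if big e then g else 1))).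
  apply: leq_sum => e _; have /forallP/(_ e) he := ostarP.
  apply: (@leq_trans (\sum_(t <- ts e) c (ostar e) (big e))).
    apply: leq_sum => t _; rewrite jwt_fj jal_fj /c.
    case: (big e); rewrite /= ?andbT.
      by case: ifP => // /andP[R1 R2]; case/orP: he => /eqP->; rewrite ?R1 ?R2.
    by case: ifP => // /and4P[R1 R2 R3 R4]; case/orP: he => /eqP->; rewrite ?R1 ?R2 ?R3 ?R4.
  rewrite big_const_seq count_predT iter_addn_0 leq_mul2l; apply/orP; right.
  by case: ifP => be; [exact: size_ts_le | rewrite /ts be].
rewrite (partition_big (fun e => ostar e) xpredT) //=; apply: leq_sum => v _.
rewrite (bigID big) /=.
rewrite (eq_bigr (fun=> c v true * g)) => [|e /andP[/eqP-> be]]; last by rewrite be.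
rewrite [X in _ + X](eq_bigr (fun=> c v false : nat)) => [|e /andP[/eqP-> be]]; last first.
  by rewrite (negbTE be) muln1.
rewrite !sum_nat_cond_const -/(K v) -/(N v) /c andbT /=.
have := K_le1 v; have := NK_le v; move: (K v) (N v) => k n.
by case: (R _); case: (R _) => /=; nia.
Qed.

Lemma fmids : map mid (dlist machs) = [seq 2 * rk v + i | v : vx <- enum vx, i : bool <- [:: false; true]].
Proof.
rewrite fmachsE map_allpairs; apply/eq_in_allpairs_dep => v _ i _; exact: mid_mj.
Qed.

Lemma fmach_cases m : m \in dlist machs -> exists v i, m = mj v i.
Proof. by rewrite fmachsE => /allpairsPdep[v [i [_ _ ->]]]; exists v, i. Qed.

Lemma fload_le (v : vx) (i : bool) :
  load lg (dlist jobs) (2 * rk v + i) <= if i then h else g.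
Proof.
(* Jobs have unit weight, so the threshold may equal the capacity; parity tells the two machines of
   a vertex apart. *)
rewrite -(mcap_mj v) -(mid_mj v); pose L n := if odd n then h else g.
have LE (u : vx) (j : bool) : L (2 * rk u + j) = if j then h else g.
  by rewrite /L oddD mul2n odd_double; case: j.
apply: (push_relabel (L := L)).
- exact: fjobs_uniq.
- rewrite fmids; apply: allpairs_uniq_dep => [|//|]; first exact: enum_uniq.
  move=> [u j] [u' j'] _ _ /= E.
  have Ej : j = j' by move: E; case: j j' => [] [] //=; lia.
  have /rk_inj-> : rk u = rk u' by move: E; rewrite Ej; lia.
  by rewrite Ej.
- by apply/allP => m /fmach_cases[u [[] ->]].
- by move=> j /fj_cases[e [t [_ ->]]]; rewrite jal_fj; case: ifP.
- move=> j /fj_cases[e [t [_ ->]]] n Hn; rewrite fmids.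
  have [u [i' ->]] : exists (u : vx) (i' : bool), n = 2 * rk u + i'.
    move: Hn; rewrite jal_fj; case: ifP => _; rewrite !inE.
      by case/orP=> /eqP->; [exists (ends e).1, false | exists (ends e).2, false]; rewrite addn0.
    by case/or4P=> /eqP->; [exists (ends e).1, false | exists (ends e).1, true
      | exists (ends e).2, false | exists (ends e).2, true]; rewrite ?addn0.
  by apply/allpairsPdep; exists u, i'; split=> //; [rewrite mem_enum | case: i'].
- by move=> m /fmach_cases[u [j ->]]; rewrite mid_mj mcap_mj LE.
- move=> m j /fmach_cases[u [i' ->]] /fj_cases[e [t [_ ->]]].
  by rewrite mid_mj mcap_mj LE jwt_fj addn1.
- move=> R; apply: leq_trans (fhall R) _; rewrite fmids [X in _ <= X]big_mkcond.
  rewrite big_allpairs_dep big_enum; apply: leq_sum => u _.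
  rewrite !big_cons big_nil !LE !addn0 /=.
  by case: (R _); case: (R _) => /=; lia.
- by rewrite fmachsE; apply/allpairsPdep; exists v, i; split=> //; [rewrite mem_enum | case: i].
Qed.

Lemma tokens_small p e : ~~ big e -> tokens p e = p (at_small e).
Proof.
move=> sm; rewrite /tokens /ts (negbTE sm) big_mkcond big_seq1 fj_small //.
Qed.

Lemma sum_small p :
  \sum_(e | ~~ big e) tokens p e = \sum_(e | ~~ big e && p (at_small e)) 1.
Proof.
by rewrite big_mkcondr; apply: eq_bigr => e sm; rewrite tokens_small.
Qed.

Lemma XY_le v : X v + Y v <= g.
Proof.
have := fload_le v false; rewrite addn0 fload (bigID big) /= sum_small addnC.
exact.
Qed.

Lemma Z_le v : Z v <= h.
Proof.
have := fload_le v true; rewrite fload (bigID big) /= sum_small.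
by apply: leq_trans; apply: leq_addl.
Qed.

Lemma inner_le_card R : #|inner (@ends G) big R| <= #|R|.
Proof.
rewrite -sum1dep_card; apply: leq_trans (sum_ends big (fun=> 1) R ostarP) _.
rewrite -sum1_card; apply: leq_sum => v _.
apply: leq_trans (K_le1 v); rewrite sum1dep_card /K; apply: subset_leq_card.
by apply/subsetP => e; rewrite !inE andbC.
Qed.

Hypothesis g_le : g <= (size es).+1.

(** All [g] tokens of a big edge inside [R] sit on even machines of [R], which share their capacity
    [g] with the extra small edges. *)
Lemma inner_extra R :
  2 * g * #|inner (@ends G) big R| + \sum_(v in R) 2 * X v <= 2 * g * #|R|.
Proof.
suff H : g * #|inner (@ends G) big R| <= \sum_(v in R) Y v.
  have HR : \sum_(v in R) X v + \sum_(v in R) Y v <= g * #|R|.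
    rewrite -big_split mulnC -sum_nat_const; apply: leq_sum => v _; exact: XY_le.
  by rewrite -big_distrr /= -!mulnA -mulnDr leq_mul2l /=; lia.
rewrite mulnC -sum_nat_cond_const exchange_big /=.
rewrite big_mkcond [X in _ <= X]big_mkcond; apply: leq_sum => e _; rewrite -/(big e).
case: ifP => // /and3P[be e1 e2]; rewrite be.
rewrite -(size_ts be g_le) -sum1_size /tokens.
under [X in _ <= X]eq_bigr do rewrite big_mkcond.
rewrite exchange_big /= big_seq [X in _ <= X]big_seq; apply: leq_sum => t Ht.
have := cur_fj Ht; rewrite jal_fj be !inE.
by case/orP=> /eqP->; [rewrite (bigD1 (ends e).1) | rewrite (bigD1 (ends e).2)]; rewrite //= eqxx.
Qed.

(** [inner_roots] is the Hall condition for this run, in which threshold and capacity are both 1 if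
    [2 * X v <= g] and both 0 otherwise. *)
Lemma bhead_le v : \sum_(e | big e && (bhead e == rk v)) 1 <= (2 * X v <= g).
Proof.
apply: (edge_run (L := fun u => 2 * X u <= g) bigjobsE bigmachsE) => [//|u e _|R].
  by rewrite addn1.
rewrite sum1dep_card; apply: leq_trans (inner_roots inner_le_card inner_extra R) _.
rewrite -sum1dep_card big_mkcondr; apply: leq_sum => u _.
by case: (2 * X u <= g).
Qed.

Lemma candB_load s T :
  (forall e, big e -> W e = b) -> (forall e, ~~ big e -> W e = s) ->
  s * (g + h) <= T -> b + s * h <= T ->
  exists2 o : assignment G, represents (candB (dV G) (dE G) (Atom b) gh) o &
    2 * mk o <= 3 * T.
Proof.
move=> Wb Ws Hgh Hbh; have [o [Ho oE]] := candB_represents; exists o => //.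
suff : mk o <= (3 * T) %/ 2 by rewrite leq_divRL // mulnC.
apply/bigmax_leqP => v _; rewrite leq_divRL // (nload_run _ oE) (bigID big) /=.
rewrite (eq_big (fun e => big e && (bhead e == rk v)) (fun=> b)); first last.
- by move=> e /andP[_ be]; rewrite Wb.
- by move=> e; rewrite andbC; case: (big e).
rewrite [X in _ + X](eq_big (fun e => ~~ big e && (at_small e %/ 2 == rk v)) (fun=> s)); first last.
- by move=> e /andP[_ be]; rewrite Ws.
- by move=> e; rewrite andbC; case: (big e).
have -> : \sum_(e | big e && (bhead e == rk v)) b =
    b * \sum_(e | big e && (bhead e == rk v)) 1.
  by rewrite big_distrr /=; apply: eq_bigr => e _; rewrite muln1.
have -> : \sum_(e | ~~ big e && (at_small e %/ 2 == rk v)) s = s * (X v + Z v).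
  rewrite (bigID (fun e => at_small e == 2 * rk v)) mulnDr !big_distrr /=.
  congr (_ + _); apply: eq_big => [e|e _]; rewrite ?muln1 // -andbA; congr (_ && _).
    by move: (at_small e) (rk v) => m n; apply/idP/idP; lia.
  by move: (at_small e) (rk v) => m n; apply/idP/idP; lia.
have := bhead_le v; have := XY_le v; have := Z_le v.
move: (\sum_(e | _) _) (X v) (Y v) (Z v) => k x y z Hz Hxy Hk.
have sz : s * z <= s * h by rewrite leq_mul2l Hz orbT.
have sx : s * x <= s * g by rewrite leq_mul2l (leq_trans (leq_addr y x) Hxy) orbT.
(* Either [2 * x <= g] and at most one big edge enters [v], or [k = 0] and the small edges alone
   weigh at most [s * (g + h)]. *)
rewrite mulnDr in Hgh; rewrite mulnDr; case: (leqP (2 * x) g) Hk => Hx /= Hk.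
  have sx2 : 2 * (s * x) <= s * g by rewrite mulnCA leq_mul2l Hx orbT.
  have [->|->] : k = 0 \/ k = 1 by lia.
    by lia.
  by lia.
have -> : k = 0 by lia.
by lia.
Qed.

End Feasible.

End Fractional.

(** * The approximation guarantee *)

Lemma candsE V E s b : dminw E = Atom s -> dmaxw E = Atom b ->
  dlist (cands V E) = flatten [seq flatten [seq
      [:: candA V E (Atom (i * s + j * b + b)); candB V E (Atom b) (Pair (Atom i) (Atom j))]
    | j <- rev (iota 0 (size (dlist E)).+1)] | i <- rev (iota 0 (size (dlist E)).+1)].
Proof.
rewrite /cands => -> ->; rewrite dfoldE drangeE; set r := rev _.
move: {1 3}r => t; elim: t => // i t IH.
rewrite [foldr _ _ _]/= dfoldE drangeE -/r [in RHS]/= -IH.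
by elim: r {IH} => //= j u ->.
Qed.

Section Guarantee.

Variable G : instance.
Let es := enum (edge G).
Local Notation wmax := (\max_(e : edge G) W e).

Lemma cands_represent c : c \in dlist (cands (dV G) (dE G)) ->
  exists o : assignment G, represents c o.
Proof.
have [s [sE _ _]] := dminwP G.
rewrite (candsE _ sE (dmaxwE G)) => /flatten_mapP[i _ /flatten_mapP[j _]].
rewrite !inE => /orP[] /eqP->.
  by have [o [Ho _]] := candA_represents G (Atom (i * s + j * wmax + wmax)); exists o.
by have [o [Ho _]] := candB_represents G wmax i j; exists o.
Qed.

Lemma nload_split (o : assignment G) v s :
  (forall e : edge G, W e = s \/ W e = wmax) ->
  nload o v = s * #|[set e | (o e == v) && ~~ (wmax <= W e)]|
            + wmax * #|[set e | (o e == v) && (wmax <= W e)]|.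
Proof.
move=> two; rewrite /nload (bigID (fun e => wmax <= W e)) /= addnC; congr (_ + _).
  rewrite mulnC -sum_nat_cond_const; apply: eq_bigr => e /andP[_ sm].
  by case: (two e) => // E; rewrite E leqnn in sm.
rewrite mulnC -sum_nat_cond_const; apply: eq_bigr => e /andP[_ be].
by apply/eqP; rewrite eqn_leq be andbT leq_bigmax.
Qed.

Lemma card_edges (A : {set edge G}) : #|A| <= size es.
Proof. by rewrite /es -cardE max_card. Qed.

Lemma good_candidate (ostar : assignment G) :
  at_most_two_weights G -> is_orientation ostar ->
  exists c (o : assignment G), [/\ c \in dlist (cands (dV G) (dE G)), represents c o
    & 2 * mk o <= 3 * mk ostar].
Proof.
move=> two ostarP; have [s [sE smin sW]] := dminwP G.
have {}two := two_weights two smin sW.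
have memc i j : i <= size es -> j <= size es ->
    {subset [:: candA (dV G) (dE G) (Atom (i * s + j * wmax + wmax));
      candB (dV G) (dE G) (Atom wmax) (Pair (Atom i) (Atom j))]
     <= dlist (cands (dV G) (dE G))}.
  move=> Hi Hj c Hc; rewrite (candsE _ sE (dmaxwE G)) dlist_dE size_map.
  apply/flatten_mapP; exists i; first by rewrite mem_rev mem_iota.
  by apply/flatten_mapP; exists j; first by rewrite mem_rev mem_iota.
(* Without edges every orientation has makespan 0, so any candidate will do. *)
case: (pickP (fun _ : edge G => true)) => [e0 _|noedge]; last first.
  have [o [Ho _]] := candB_represents G wmax 0 0.
  exists (candB (dV G) (dE G) (Atom wmax) (Pair (Atom 0) (Atom 0))), o; split=> //.
    by apply: (memc 0 0) => //; rewrite !inE eqxx orbT.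
  suff -> : mk o = 0 by [].
  apply/eqP; rewrite -leqn0; apply/bigmax_leqP => v _; rewrite /nload big1 // => e.
  by have := noedge e.
set T := mk ostar; set b := wmax in memc sW two *.
have [e1 E1] : exists e1 : edge G, b = W e1.
  have [|e1 _ E1] := @eq_bigmax_cond _ predT (fun e : edge G => W e).
    by apply/card_gt0P; exists e0.
  by exists e1.
have bT : b <= T.
  apply: leq_trans (nload_mk ostar (ostar e1)).
  by rewrite E1 /nload (bigD1 e1) //= leq_addr.
have s_gt0 : 0 < s by case: sW => [->|[e ->]]; rewrite ?E1 W_gt0.
pose N v := #|[set e | (ostar e == v) && ~~ (b <= W e)]|.
pose K v := #|[set e | (ostar e == v) && (b <= W e)]|.
have loadE v : nload ostar v = s * N v + b * K v by apply: nload_split.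
have loadT v : s * N v + b * K v <= T by rewrite -loadE; apply: nload_mk.
have [Hb|Hb] := leqP (2 * b) T.
  have [v Tv] : exists v, T = nload ostar v.
    have [|v _ Ev] := @eq_bigmax_cond _ predT (fun v => nload ostar v).
      by apply/card_gt0P; exists (ends e0).1.
    by exists v.
  have [|o Ho Hle] := candA_load (b := b) ostarP; first by move=> e; apply: leq_bigmax.
  exists (candA (dV G) (dE G) (Atom (T + b))), o; split=> //; last by move: Hle; rewrite -/T; lia.
  (* The numbers of small and big edges at a vertex of maximum load in [ostar] form the pair that
     guesses [T]. *)
  apply: (memc (N v) (K v)); try exact: card_edges.
  by rewrite !inE Tv loadE mulnC [b * _]mulnC eqxx.
(* Here [a] stands for [g + h]. Capping at [|E|] keeps the pair in the search range and is harmless,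
   as no vertex receives more than [|E|] small edges. *)
pose h := minn (size es) ((T - b) %/ s).
pose a := minn (size es) (T %/ s).
have ha : h <= a by rewrite /h /a; have := @leq_div2r s (T - b) T (leq_subr b T); lia.
have ghE : (a - h) + h = a by rewrite subnK.
have b_gt0 : 0 < b by rewrite E1 W_gt0.
have K1 v : K v <= 1 by have := loadT v; nia.
have NK v : N v + (a - h) * K v <= (a - h) + h.
  have Nm : N v <= size es by exact: card_edges.
  have [EK|EK] : K v = 0 \/ K v = 1 by have := K1 v; lia.
    rewrite EK muln0 addn0 ghE leq_min Nm leq_divRL // mulnC.
    by have := loadT v; lia.
  rewrite EK muln1 addnC leq_add2l leq_min Nm leq_divRL // mulnC.
  by have := loadT v; rewrite EK; lia.
have am : a <= size es by rewrite geq_minl.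
have [|||||o Ho Hle] := @candB_load G b (a - h) h ostar ostarP K1 NK _ s T.
- exact: leq_trans (leq_subr _ _) (leqW am).
- by move=> e be; apply/eqP; rewrite eqn_leq be andbT leq_bigmax.
- by move=> e sm; case: (two e) => // E; rewrite E leqnn in sm.
- by rewrite ghE; apply: leq_trans (leq_trunc_div T s); rewrite mulnC leq_mul2r geq_minr orbT.
- have : h * s <= T - b.
    by apply: leq_trans (leq_trunc_div (T - b) s); rewrite leq_mul2r geq_minr orbT.
  by rewrite [s * h]mulnC; lia.
exists (candB (dV G) (dE G) (Atom b) (Pair (Atom (a - h)) (Atom h))), o; split=> //.
by apply: (memc (a - h) h); [lia | rewrite geq_minl | rewrite !inE eqxx orbT].
Qed.

Lemma balance_correct : at_most_two_weights G ->
  exists o : assignment G, [/\ balance (enc_instance G) = enc_orientation o,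
    is_orientation o & (makespan o <= 3%:R / 2%:R * OPT G)%R].
Proof.
move=> two; have [o Ho Hmin] := bestP cands_represent.
exists o; split; [exact: balanceE | by case: Ho |].
rewrite /OPT; case: arg_minP => [|ostar Hs _]; first exact: default_orientationP.
have [c [o' [Hc Ho' Hle]]] := good_candidate two Hs.
have {Hc Ho'}Hoo' := Hmin c o' Hc Ho'.
have D0 : (0 < Den G)%N := Den_gt0 G.
rewrite !makespanE mulrA ler_pM2r ?invr_gt0 ?ltr0n // mulrAC ler_pdivlMr ?ltr0n //.
by rewrite -!natrM ler_nat; lia.
Qed.

End Guarantee.

Local Open Scope ring_scope.

Theorem theorem1 :
  exists p : program,
    poly_time_on (fun G : instance => at_most_two_weights G) p /\
    approximates_on (fun G : instance => at_most_two_weights G) (3%:R / 2%:R) p.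
Proof.
have [p [c H]] := PT_balance; exists p; split.
  (* An input has size [n >= 1], so [n + c <= (1 + c) * n]. *)
  exists ((1 + c) ^ c)%N, c => G _; have [t Ht le_t] := H (enc_instance G).
  exists (balance (enc_instance G)), t; split=> //.
  apply: leq_trans le_t (leq_trans _ (leq_addr _ _)); rewrite -expnMn.
  by apply: leq_exp; have := dsize_gt0 (enc_instance G); nia.
move=> G two; have [o [Ho1 Ho2 Ho3]] := balance_correct two.
have [t Ht _] := H (enc_instance G); exists o, t; split=> //.
by rewrite -Ho1.
Qed.
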